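(* Let $\mathsf S$ be an $(n-1)$-dimensional simple polytope in $\mathbb R^n$ whose affine span is not linear (does not contain the origin), and let $\mathsf P$ be an omnitruncation of $\mathsf S$. Then the set of deep truncations $\{\operatorname{DTr}[\mathsf S,\mathsf F] : \mathsf F\subsetneq\mathsf S\}$ (over all proper faces of $\mathsf S$ including $\mathsf F=\emptyset$) is a polytopal basis for the deformation space of $\mathsf P$.
   Context: Conventions. Polytopes live in $\mathbb R^n$ with lattice $\mathbb Z^n$ and the dot product, and have rational facet normals and affine span. $h(\mathsf P,u)=\min_{x\in\mathsf P}u\cdot x$. The normal fan $\Sigma(\mathsf P)$ is the collection of normal cones $\{u : u\cdot x=h(\mathsf P,u)\ \forall x\in\mathsf F\}$ of nonempty faces $\mathsf F$; its lineality space is $\mathsf L=\{w : w\cdot x\text{ constant on }\mathsf P\}$. A fan coarsens another if each of its cones is a union of cones of the other. Face normals. For a facet $\mathsf G$ of $\mathsf S$, $u_{\mathsf G}\in\mathbb Z^n$ is a fixed inner normal vector whose image in $\mathbb Z^n/(\mathbb Z^n\cap\mathsf L)$ is primitive; for a nonempty proper face $\mathsf F$, $u_{\mathsf F}=\sum_{\mathsf G\supseteq\mathsf F}u_{\mathsf G}$ over the facets containing $\mathsf F$. (Truncations below do not depend on the choice.) Truncations. $\operatorname{Tr}_\epsilon[\mathsf S,\mathsf F]=\{x\in\mathsf S : u_{\mathsf F}\cdot x\ge h(\mathsf S,u_{\mathsf F})+\epsilon\}$ for a nonempty proper face $\mathsf F$. A vertex $y\notin\mathsf F$ is a neighbor of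 $\mathsf F$ if it is joined by an edge to a vertex of $\mathsf F$; $\delta_{\mathsf F}=\min\{u_{\mathsf F}\cdot y-h(\mathsf S,u_{\mathsf F}) : y\text{ a neighbor of }\mathsf F\}$. The truncation is shallow if $0<\epsilon<\delta_{\mathsf F}$; $\operatorname{DTr}[\mathsf S,\mathsf F]=\operatorname{Tr}_{\delta_{\mathsf F}}[\mathsf S,\mathsf F]$. By convention $\operatorname{DTr}[\mathsf S,\emptyset]=\mathsf S$. Omnitruncation. List the nonempty proper faces as $\mathsf F_1,\dots,\mathsf F_m$ in an order extending inclusion (smaller faces first), let $\mathsf S_0=\mathsf S$, and for numbers $\epsilon_{\mathsf F}>0$ let $\mathsf S_i=\operatorname{Tr}_{\epsilon_{\mathsf F_i}}[\mathsf S_{i-1},\mathsf F_i\cap\mathsf S_{i-1}]$ (direction $u_{\mathsf F_i}$). If each truncation is shallow, $\mathsf S_m$ is an omnitruncation of $\mathsf S$. Its normal fan is the barycentric subdivision of $\Sigma(\mathsf S)$, with cones $\operatorname{Cone}(u_{\mathsf F_1},\dots,u_{\mathsf F_k})+\mathsf L$ over chains $\mathsf F_1\subsetneq\dots\subsetneq\mathsf F_k$ of nonempty proper faces. Deformations. The deformation space of $\mathsf P$ is the vector space $\operatorname{PL}(\Sigma(\mathsf P))$ of functions on $\mathbb R^n$ linear on each cone of $\Sigma(\mathsf P)$. A polytopal basis for it is a collection of polytopes with normal fans coarsening $\Sigma(\mathsf P)$ whose support functions form a basis of $\operatorname{PL}(\Sigma(\mathsf P))$. *)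

(* Defs.v *)
From HB Require Import structures.
From mathcomp Require Import all_boot all_order all_algebra.
From mathcomp Require Import all_classical all_reals.

Set Implicit Arguments.
Unset Strict Implicit.
Unset Printing Implicit Defensive.

Import Order.TTheory GRing.Theory Num.Theory.

Local Open Scope classical_set_scope.
Local Open Scope card_scope.
Local Open Scope ring_scope.

Section Polytopes.
Variables (R : realType) (n : nat).
Local Notation V := 'rV[R]_n.
Implicit Types (P S F G E A : set V) (u v w x y : V).

Definition dot u x : R := \sum_(i < n) u 0 i * x 0 i.

Definition integral_vec u : Prop := u \is a mxOver Num.int.

Definition aff_span A : set V :=
  [set x | exists k (p : 'I_k -> V) (c : 'I_k -> R),
     [/\ forall i, A (p i), \sum_i c i = 1 & x = \sum_i c i *: p i]].

(* The affine span of A has dimension d: A contains affinely independent points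
   p, p + M_1, ..., p + M_d, and is contained in their affine span. In
   particular A is nonempty; the empty set has no dimension in nat. *)
Definition has_dim A (d : nat) : Prop :=
  exists p (M : 'M[R]_(d, n)),
    [/\ A p, row_free M, forall i, A (p + row i M)
      & forall x, A x -> (x - p <= M)%MS].

(* The infimum is a minimum whenever P is nonempty and compact. *)
Definition supp P u : R := inf [set dot u x | x in P].

Definition lineality P : set V :=
  [set w | forall x y, P x -> P y -> dot w x = dot w y].

Definition face_in P u : set V := [set x | P x /\ dot u x = supp P u].

Definition face P F : Prop := F = set0 \/ exists u, F = face_in P u.

Definition facet P G : Prop :=
  face P G /\ exists d, has_dim P d.+1 /\ has_dim G d.

Definition vertex P v : Prop := face P [set v].

Definition edge P E : Prop := face P E /\ has_dim E 1%N.

(* Only the directions of the facet normals and of the equations of the affine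
   span are required to be rational: offsets and vertices may be irrational. *)
Definition rational_span P : Prop :=
  aff_span P = [set x | forall w y,
    integral_vec w -> lineality P w -> P y -> dot w x = dot w y].

Definition rational_facet_normals P : Prop :=
  forall G, facet P G -> exists2 u, integral_vec u & G = face_in P u.

Definition polytope P : Prop :=
  [/\ P !=set0,
      exists k (a : 'I_k -> V) (b : 'I_k -> R),
        P = [set x | forall i, b i <= dot (a i) x],
      exists M : R, forall x, P x -> forall i, `|x 0 i| <= M,
      rational_span P
    & rational_facet_normals P].

Definition simple_polytope S : Prop :=
  polytope S /\ exists2 d, has_dim S d &
    forall v, vertex S v -> [set G | facet S G /\ G v] #= `I_d.

Definition normal_cone P F : set V :=
  [set u | forall x, F x -> dot u x = supp P u].

Definition normal_fan P : set (set V) :=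
  [set C | exists F, [/\ face P F, F !=set0 & C = normal_cone P F]].

Definition coarsens (Sigma Sigma' : set (set V)) : Prop :=
  forall C, Sigma C ->
    exists2 D, D `<=` Sigma' & C = \bigcup_(c in D) c.

(* The image of u in Z^n / (Z^n :&: L) is primitive, where L is the lineality
   space of P: it is not zero (the case k = 0) and not a proper multiple. *)
Definition primitive_mod P u : Prop :=
  forall (k : nat) v, integral_vec v -> lineality P (u - v *+ k) -> k = 1%N.

Definition facet_normals S (uG : set V -> V) : Prop :=
  forall G, facet S G ->
    [/\ integral_vec (uG G), G = face_in S (uG G) & primitive_mod S (uG G)].

Definition face_normal S (uG : set V -> V) F : V :=
  \sum_(G \in [set G | facet S G /\ F `<=` G]) uG G.

(* The direction u is an argument: in an omnitruncation, a face of an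
   intermediate polytope is cut off in the direction of a face normal of the
   initial polytope. *)
Definition truncation P u (eps : R) : set V :=
  [set x | P x /\ supp P u + eps <= dot u x].

Definition neighbor P F y : Prop :=
  [/\ vertex P y, ~ F y
    & exists v E, [/\ vertex P v, F v, edge P E, E v & E y]].

Definition depth P F u : R :=
  inf [set dot u y - supp P u | y in neighbor P F].

Definition deep_truncation S (uG : set V -> V) F : set V :=
  if `[< F = set0 >] then S
  else let u := face_normal S uG F in truncation S u (depth S F u).

(* A shallow depth 0 < eps < depth forces the cut off set F i `&` T i to be a
   nonempty proper face of T i. *)
Definition omnitruncation S (uG : set V -> V) P : Prop :=
  exists (m : nat) (F : nat -> set V) (eps : set V -> R) (T : nat -> set V),
  [/\ set_bij `I_m [set A | [/\ face S A, A !=set0 & A `<` S]] F,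
      forall i j, (i < m)%N -> (j < m)%N -> F i `<` F j -> (i < j)%N,
      T 0%N = S /\ T m = P
    & forall i, (i < m)%N -> let u := face_normal S uG (F i) in
        0 < eps (F i) < depth (T i) (F i `&` T i) u /\
        T i.+1 = truncation (T i) u (eps (F i))].

Definition PL (Sigma : set (set V)) : set (V -> R) :=
  [set f | forall C, Sigma C ->
     exists l : {scalar V}, forall x, C x -> f x = l x].

(* The family b, indexed by A, is a basis of the space of functions W; linear
   combinations are finite, A itself need not be. *)
Definition function_basis (I : choiceType) (W : set (V -> R)) (A : set I)
    (b : I -> V -> R) : Prop :=
  [/\ forall i, A i -> W (b i),
      forall f, W f -> exists2 c : I -> R, finite_set [set i | c i != 0]
        & forall x, f x = \sum_(i \in A) c i * b i x
    & forall c : I -> R, finite_set [set i | c i != 0] ->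
        (forall x, \sum_(i \in A) c i * b i x = 0) ->
        forall i, A i -> c i = 0].

Definition polytopal_basis P (B : set (set V)) : Prop :=
  (forall Q, B Q -> polytope Q /\ coarsens (normal_fan Q) (normal_fan P)) /\
  function_basis (PL (normal_fan P)) B supp.

End Polytopes.

(* Main.v *)
(** Let w.x = c, with c <> 0, be the affine hull of S and let the slack of x in a
facet G be u_G.x - h(S, u_G). As S is simple, its nonempty faces correspond to
simplices, the sets of facets containing them, and a flag of S is an ordering of
the facets at a vertex. Write s_F for the sum of the slacks over the facets
containing F, so that a truncation at F is a bound s_F >= e_F.

Normal fan of P: by induction along the truncations, for every flag there is a
point of the truncated polytope at which s_F is the current bound for each F in
the flag and no other bound is attained. When F itself is cut off, the points of
the flags through F slide along the edges leaving F and stop before the neighbors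
of F since the cut is shallow; all other points survive because a vertex outside F
is at least as high as the lowest neighbor (from any vertex that is not a minimum
an edge leads downwards). Near the final points P is a simplicial cone, so the
normal cones of P are the cones over chains.

Basis: on the cone of a flag, all the u_F in the flag attain their minimum over
DTr[S,G] at a common point, whence the support function of DTr[S,G] is linear
there and takes at u_F the value h(S, u_F) + delta_G if F is contained in G, and
h(S, u_F) otherwise. This system is triangular for inclusion, and evaluation at w
accounts for the remaining dimension. *)

(* Everything is computed from a list of inequalities, with vertices as basic feasible points.
   Boundedness enters as the absence of recession directions, a condition on the normals alone that
   every polyhedron with further bounds inherits. The vertices of the intermediate polytopes are
   never listed: one point per flag is tracked, and this suffices because every functional lies in
   the cone of some flag, where a common minimum of the normals of the flag is a minimum of the
   functional. The obstacle is that a shallow depth compares a face with its neighbors only; descent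
   along edges extends this bound to all vertices off the face, in particular to the tracked points.
   All support functions in question take the value c at w, so that evaluation at w determines the
   sum of the coefficients of a linear combination; this is where c <> 0 is used. *)
Require Import Defs.
From HB Require Import structures.
From mathcomp Require Import all_boot all_order all_algebra.
From mathcomp Require Import all_classical all_reals.
From mathcomp Require Import ring lra.

Set Implicit Arguments.
Unset Strict Implicit.
Unset Printing Implicit Defensive.

Import Order.TTheory GRing.Theory Num.Theory.

Local Open Scope classical_set_scope.
Local Open Scope ring_scope.

(** * Scalar product *)

Section Dot.
Variables (R : realType) (n : nat).
Implicit Types u v x y : 'rV[R]_n.

Lemma dotE u x : dot u x = (u *m x^T) 0 0.
Proof. by rewrite /dot mxE; apply: eq_bigr => i _; rewrite !mxE. Qed.

Lemma dotDl u v x : dot (u + v) x = dot u x + dot v x.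
Proof. by rewrite !dotE mulmxDl mxE. Qed.

Lemma dotDr u x y : dot u (x + y) = dot u x + dot u y.
Proof. by rewrite !dotE linearD mulmxDr mxE. Qed.

Lemma dotZl k u x : dot (k *: u) x = k * dot u x.
Proof. by rewrite !dotE -scalemxAl mxE. Qed.

Lemma dotZr k u x : dot u (k *: x) = k * dot u x.
Proof. by rewrite !dotE linearZ -scalemxAr mxE. Qed.

Lemma dotNl u x : dot (- u) x = - dot u x.
Proof. by rewrite -scaleN1r dotZl mulN1r. Qed.

Lemma dotNr u x : dot u (- x) = - dot u x.
Proof. by rewrite -scaleN1r dotZr mulN1r. Qed.

Lemma dotBr u x y : dot u (x - y) = dot u x - dot u y.
Proof. by rewrite dotDr dotNr. Qed.

Lemma dot0l x : dot 0 x = 0.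
Proof. by rewrite dotE mul0mx mxE. Qed.

Lemma dot0r u : dot u 0 = 0.
Proof. by rewrite dotE trmx0 mulmx0 mxE. Qed.

Lemma dot_suml (I : Type) (r : seq I) (A : pred I) (f : I -> 'rV[R]_n) x :
  dot (\sum_(i <- r | A i) f i) x = \sum_(i <- r | A i) dot (f i) x.
Proof. by rewrite (big_morph (fun u => dot u x) (fun u v => dotDl u v x) (dot0l x)). Qed.

Lemma dot_sumr (I : Type) (r : seq I) (A : pred I) u (f : I -> 'rV[R]_n) :
  dot u (\sum_(i <- r | A i) f i) = \sum_(i <- r | A i) dot u (f i).
Proof. by rewrite (big_morph (dot u) (dotDr u) (dot0r u)). Qed.

Lemma dot_self_gt0 x : x != 0 -> 0 < dot x x.
Proof.
move=> x0; rewrite lt_neqAle; apply/andP; split; last first.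
  by apply: sumr_ge0 => i _; exact: sqr_ge0.
apply: contra x0 => /eqP/esym; rewrite /dot => /psumr_eq0P h.
apply/eqP/rowP => i; rewrite mxE.
by have /eqP := h (fun i _ => sqr_ge0 (x 0 i)) i isT; rewrite -expr2 sqrf_eq0 => /eqP.
Qed.

Lemma row_expand d (M : 'M[R]_(d, n)) x :
  (x <= M)%MS -> exists c : 'I_d -> R, x = \sum_i c i *: row i M.
Proof.
move=> /submxP[c ->]; exists (fun i => c 0 i).
by rewrite mulmx_sum_row.
Qed.

End Dot.

Definition dot_simp := (dotDl, dotDr, dotZl, dotZr, dotNl, dotNr, dot0l, dot0r).

Section DualBasis.
Variables (R : realType) (m : nat).
Local Notation V := 'rV[R]_(m.+1).

(** The hypothesis makes the square matrix with rows [w] and [a i] invertible; [e] consists of the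
    rows of its inverse transpose, except the one dual to [w]. *)
Lemma dual_basis (w : V) (a : 'I_m -> V) :
  (forall d, dot w d = 0 -> (forall i, dot (a i) d = 0) -> d = 0) ->
  exists e : 'I_m -> V,
    [/\ forall k, dot w (e k) = 0,
        forall i k, dot (a i) (e k) = (i == k)%:R
      & forall u, exists l, u = \sum_k dot u (e k) *: a k + l *: w].
Proof.
move=> span.
pose A : 'M[R]_(m.+1) := (col_mx w (\matrix_i a i) : 'M_(1 + m, m.+1)).
have A0 : row (lshift m ord0 : 'I_(1 + m)) A = w.
  by rewrite /A rowKu; apply/rowP => j; rewrite mxE.
have Ai i : row (rshift 1 i : 'I_(1 + m)) A = a i.
  by rewrite /A rowKd rowK.
have dotA d i : (d *m A^T) 0 i = dot (row i A) d.
  by rewrite mxE; apply: eq_bigr => j _; rewrite !mxE mulrC.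
have Afree : row_free A^T.
  apply: inj_row_free => d /rowP d0; apply: span => [|i].
    by have := d0 (lshift m ord0 : 'I_(1 + m)); rewrite dotA A0 mxE.
  by have := d0 (rshift 1 i : 'I_(1 + m)); rewrite dotA Ai mxE.
have Aunit : A^T \in unitmx by rewrite -row_free_unit.
pose B := invmx A^T.
have rowB j i : dot (row i A) (row j B) = (j == i)%:R.
  rewrite -dotA -row_mul mulVmx// !mxE //.
exists (fun k => row (rshift 1 k : 'I_(1 + m)) B); split.
- by move=> k; rewrite -A0 rowB.
- move=> i k; by rewrite -Ai rowB -val_eqE /= eqn_add2l eq_sym.
move=> u; exists (dot u (row (lshift m ord0 : 'I_(1 + m)) B)).
have uE : u = \sum_(i < 1 + m) dot u (row i B) *: row i A.
  transitivity (u *m B^T *m A).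
    have: A^T *m B = 1%:M by rewrite mulmxV.
    move/(congr1 trmx); rewrite trmx_mul trmxK trmx1 => h.
    by rewrite -mulmxA h mulmx1.
  rewrite mulmx_sum_row; apply: eq_bigr => i _; congr (_ *: _).
  by rewrite /dot mxE; apply: eq_bigr => j _; rewrite !mxE.
rewrite {1}uE big_split_ord/= addrC; congr (_ + _).
  by apply: eq_bigr => i _; rewrite Ai.
by rewrite big_ord1 A0.
Qed.

End DualBasis.

(** * Vertices and edges of polyhedra *)

Lemma fin_small (R : realType) (I : finType) (Q : I -> R -> Prop) :
  (forall i, exists2 e, 0 < e & forall t, 0 <= t <= e -> Q i t) ->
  exists2 e, 0 < e & forall t, 0 <= t <= e -> forall i, Q i t.
Proof.
move=> h; have {}h i : exists e, 0 < e /\ forall t, 0 <= t <= e -> Q i t.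
  by have [e] := h i; exists e.
have [e he] := choice h.
(* Starting the minimum at [1] keeps it positive when [I] is empty. *)
exists (\big[Num.min/1]_i e i).
  apply: (big_ind (fun x => 0 < x)) => // [x y x0 y0|i _]; first by rewrite lt_min x0.
  by have [] := he i.
move=> t /andP[t0 te] i; have [_] := he i; apply; rewrite t0/=.
by apply: le_trans te _; exact: bigmin_le.
Qed.

Lemma seq_min (R : realType) (T : eqType) (s : seq T) (f : T -> R) (x0 : T) :
  x0 \in s -> exists2 x, x \in s & forall y, y \in s -> f x <= f y.
Proof.
elim: s x0 => // a s IH x0 _.
case: s IH => [|b s] IH.
  by exists a; rewrite ?inE// => y; rewrite inE => /eqP ->.
have [x xs xmin] := IH b (mem_head _ _).
have [ax|xa] := leP (f a) (f x).
  exists a; rewrite ?mem_head// => y; rewrite inE => /orP[/eqP ->//|ys].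
  exact: le_trans ax (xmin _ ys).
exists x; first by rewrite inE xs orbT.
move=> y; rewrite inE => /orP[/eqP ->|ys]; [exact: ltW|exact: xmin].
Qed.

Section Supp.
Variables (R : realType) (n : nat) (P : set 'rV[R]_n).
Implicit Types u x y : 'rV[R]_n.

Lemma supp_min u x :
  P x -> (forall y, P y -> dot u x <= dot u y) -> supp P u = dot u x.
Proof.
move=> Px xmin; apply/eqP; rewrite eq_le; apply/andP; split.
  apply: ge_inf; last by exists x.
  by exists (dot u x) => _ [y Py <-]; exact: xmin.
by apply: lb_le_inf; [exists (dot u x), x|move=> _ [y Py <-]; exact: xmin].
Qed.

Lemma face_in_min u x :
  P x -> (forall y, P y -> dot u x <= dot u y) -> face_in P u x.
Proof. by move=> Px h; split=> //; rewrite (supp_min Px h). Qed.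

End Supp.

Section Polyhedron.
Variables (R : realType) (n : nat) (I : finType).
Variables (a : I -> 'rV[R]_n) (b : I -> R).
Local Notation V := 'rV[R]_n.
Implicit Types u x y z d : V.

Definition polyhedron : set V := [set x | forall i, b i <= dot (a i) x].
Local Notation P := polyhedron.

Definition tight x : {set I} := [set i | dot (a i) x == b i].

(** Stands in for boundedness: it involves the normals only, so it survives any change of offsets
    and any added constraint. *)
Definition no_recession := forall d, d != 0 -> exists i, dot (a i) d < 0.

(** Basic feasible points in the sense of linear programming; [basic_vertex] identifies them with
    the vertices. *)
Definition basic x :=
  P x /\ forall d, (forall i, i \in tight x -> dot (a i) d = 0) -> d = 0.

Lemma tightP x i : reflect (dot (a i) x = b i) (i \in tight x).
Proof. by rewrite inE; exact: eqP. Qed.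

Lemma not_tight_lt x i : P x -> i \notin tight x -> b i < dot (a i) x.
Proof. by move=> Px; rewrite inE lt_neqAle Px eq_sym => ->. Qed.

Lemma small_step x d : P x -> (forall i, i \in tight x -> 0 <= dot (a i) d) ->
  exists2 e, 0 < e & forall t, 0 <= t <= e -> P (x + t *: d).
Proof.
move=> Px xd; apply: (@fin_small _ _ (fun i t => b i <= dot (a i) (x + t *: d))).
move=> i; have [d0|d0] := leP 0 (dot (a i) d).
  exists 1 => // t /andP[t0 _]; rewrite !dot_simp.
  by apply: le_trans (Px i) _; rewrite lerDl mulr_ge0.
have xi : b i < dot (a i) x.
  apply: not_tight_lt => //; apply: contraL d0 => /xd; by rewrite leNgt.
exists ((dot (a i) x - b i) / - dot (a i) d).
  by rewrite divr_gt0// ?subr_gt0// oppr_gt0.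
move=> t /andP[t0]; rewrite ler_pdivlMr ?oppr_gt0// !dot_simp; lra.
Qed.

(** Ratio test: [f i] is the parameter at which a constraint decreasing along [d] becomes tight, and
    the least such parameter is taken. *)
Lemma ray_exit x d i0 :
  P x -> (forall i, i \in tight x -> 0 <= dot (a i) d) -> dot (a i0) d < 0 ->
  exists t, [/\ 0 < t, P (x + t *: d)
    & exists2 i, dot (a i) d < 0 & i \in tight (x + t *: d)].
Proof.
move=> Px xd i0d.
pose f i := (dot (a i) x - b i) / - dot (a i) d.
have /= [i id imin] :=
  @arg_minP _ R I i0 (fun i => dot (a i) d < 0) f i0d.
have xi : b i < dot (a i) x.
  apply: not_tight_lt => //; apply: contraL id => /xd; by rewrite leNgt.
have f0 : 0 < f i by rewrite divr_gt0// ?subr_gt0// oppr_gt0.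
exists (f i); split => //.
  move=> j; rewrite !dot_simp; have [d0|d0] := leP 0 (dot (a j) d).
    by apply: le_trans (Px j) _; rewrite lerDl mulr_ge0// ltW.
  have := imin _ d0; rewrite /f ler_pdivlMr ?oppr_gt0// -/(f i); lra.
exists i => //; apply/tightP; rewrite !dot_simp /f invrN mulrN mulNr mulfVK ?lt_eqF//.
by rewrite opprB addrC subrK.
Qed.

(** While [x] is not basic, some nonzero direction keeps all tight constraints tight. One of its two
    signs does not increase [u], and following it to the exit makes a further constraint tight, so
    the number of the others drops. *)
Lemma to_basic u x : no_recession -> P x ->
  exists v, [/\ basic v, dot u v <= dot u x & tight x \subset tight v].
Proof.
move=> nr; move: {2}_.+1 (ltnSn #|~: tight x|) => k.
elim: k x => // k IH x; rewrite ltnS => xk Px.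
have [xb|xnb] := pselect (basic x); first by exists x.
have [d [xd d0]] : exists d, (forall i, i \in tight x -> dot (a i) d = 0) /\ d != 0.
  apply: contrapT => h; apply: xnb; split=> // d xd; apply/eqP; apply/negPn/negP => d0.
  by apply: h; exists d.
wlog ud : d xd d0 / dot u d <= 0.
  move=> wl; have [ud|ud] := leP (dot u d) 0; first exact: (wl d).
  apply: (wl (- d)); rewrite ?oppr_eq0 ?dotNr ?oppr_le0 ?ltW//.
  by move=> i /xd; rewrite dotNr => ->; rewrite oppr0.
have [i0 i0d] := nr _ d0.
have [|t [t0 Py [i id it]]] := ray_exit Px _ i0d; first by move=> i /xd ->.
have sub : tight x \subset tight (x + t *: d).
  apply/fintype.subsetP => j jx; apply/tightP; rewrite !dot_simp xd// mulr0 addr0.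
  exact/tightP.
have [|//|v [bv uv xv]] := IH (x + t *: d).
  apply: leq_trans xk; apply: proper_card; rewrite properC properE sub/=.
  by apply/fintype.subsetPn; exists i => //; apply: contraL id => /xd ->; rewrite ltxx.
exists v; split=> //; last exact: fintype.subset_trans xv.
apply: le_trans uv _; rewrite !dot_simp gerDl; exact: mulr_ge0_le0 (ltW t0) ud.
Qed.

Lemma basic_inj x y : basic x -> P y -> tight x \subset tight y -> x = y.
Proof.
move=> [_ xs] Py /fintype.subsetP xy; apply/eqP; rewrite -subr_eq0; apply/eqP.
apply: xs => i ix; rewrite dotBr (tightP _ _ ix) (tightP _ _ (xy _ ix)).
by rewrite subrr.
Qed.

(** By [basic_inj] a basic point is determined by its tight set, so there is at most one for each
    subset of [I]. *)
Lemma basic_seq : exists s : seq V, forall v, v \in s <-> basic v.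
Proof.
pose Q (A : {set I}) v := basic v /\ tight v = A.
pose f A := if pselect (exists v, Q A v) is left h then Some (projT1 (cid h)) else None.
exists (pmap f (enum {set I})) => v; rewrite mem_pmap; split.
  move=> /mapP[A _]; rewrite /f; case: pselect => // h [->].
  by case: (cid h) => /= ? [].
move=> bv; apply/mapP; exists (tight v); first by rewrite mem_enum.
rewrite /f; case: pselect => [h|[]]; last by exists v.
case: (cid h) => /= w [bw wv]; congr Some; apply: basic_inj => //; first by case: bw.
by rewrite wv.
Qed.

Lemma supp_attained u : no_recession -> P !=set0 ->
  exists v, basic v /\ forall y, P y -> dot u v <= dot u y.
Proof.
move=> nr [x Px]; have [s sP] := basic_seq.
have [v0 [/sP v0s _ _]] := to_basic u nr Px.
have [v /sP bv vmin] := seq_min (dot u) v0s.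
exists v; split=> // y /(to_basic u nr) [w [/sP ws wy _]].
exact: le_trans (vmin _ ws) wy.
Qed.

Lemma supp_le u x : no_recession -> P x -> supp P u <= dot u x.
Proof.
move=> nr Px; have [v [[Pv _] vm]] := supp_attained u nr (ex_intro _ x Px).
by rewrite (supp_min Pv vm) vm.
Qed.

(** A sum of nonnegative slacks vanishes only if each of them does; [y] guarantees that the value
    zero is attained. *)
Lemma face_sum (A : {set I}) y : P y -> A \subset tight y ->
  face_in P (\sum_(i in A) a i) = [set x | P x /\ A \subset tight x].
Proof.
move=> Py /fintype.subsetP Ay.
have ymin x : P x -> dot (\sum_(i in A) a i) y <= dot (\sum_(i in A) a i) x.
  by move=> Px; rewrite !dot_suml; apply: ler_sum => i /Ay/tightP ->; exact: Px.
apply/seteqP; split=> x /= [Px]; last first.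
  move=> /fintype.subsetP Ax; split=> //; rewrite (supp_min Py ymin) !dot_suml.
  by apply: eq_bigr => i iA; rewrite (tightP _ _ (Ax _ iA)) (tightP _ _ (Ay _ iA)).
rewrite (supp_min Py ymin) !dot_suml => xy; split=> //.
apply/fintype.subsetP => i iA; apply/tightP.
have : \sum_(j in A) (dot (a j) x - b j) = 0.
  rewrite big_split/= xy sumrN; apply/eqP; rewrite subr_eq0; apply/eqP.
  by apply: eq_bigr => j /Ay/tightP.
move=> /psumr_eq0P h; apply/eqP; rewrite -subr_eq0; apply/eqP; apply: h => // j _.
by rewrite subr_ge0; exact: Px.
Qed.

Lemma basic_vertex v : no_recession -> basic v <-> vertex P v.
Proof.
move=> nr; split=> [bv|].
  right; exists (\sum_(i in tight v) a i); have [Pv _] := bv.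
  rewrite (face_sum Pv)//; apply/seteqP; split=> [x ->//|x [Px vx]].
  by rewrite /= (basic_inj bv Px vx).
case=> [/seteqP[/(_ v erefl)//]|[u fu]].
have [Pv uv] : face_in P u v by rewrite -fu.
have [w [bw wv _]] := to_basic u nr Pv; suff -> : v = w by [].
suff : [set v] w by move=> /= ->.
rewrite fu; split; first by case: bw.
by apply/eqP; rewrite eq_le supp_le ?andbT -?uv//; case: bw.
Qed.

End Polyhedron.

(** * Dimension and facets *)

Section Dimension.
Variables (R : realType) (n : nat).
Implicit Types (A B : set 'rV[R]_n) (p q : 'rV[R]_n).

Lemma directions_sub A B d d' p q (M : 'M[R]_(d, n)) (M' : 'M[R]_(d', n)) :
  A `<=` B -> A p -> (forall i, A (p + row i M)) ->
  (forall x, B x -> (x - q <= M')%MS) -> (M <= M')%MS.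
Proof.
move=> AB Ap AM BM; apply/row_subP => i.
have -> : row i M = (p + row i M - q) - (p - q).
  by rewrite opprB addrA subrK addrAC subrr add0r.
by rewrite addmx_sub ?eqmx_opp; [|apply/BM/AB/AM|apply/BM/AB].
Qed.

Lemma has_dim_le A B d d' : A `<=` B -> has_dim A d -> has_dim B d' -> (d <= d')%N.
Proof.
move=> AB [p [M [Ap Mf AM _]]] [q [M' [_ M'f _ BM]]].
have := mxrankS (directions_sub AB Ap AM BM).
by move: Mf M'f => /eqP -> /eqP ->.
Qed.

Lemma has_dim_uniq A d d' : has_dim A d -> has_dim A d' -> d = d'.
Proof. by move=> h h'; apply/anti_leq; rewrite !(@has_dim_le A A). Qed.

Lemma dot_row_space d (M : 'M[R]_(d, n)) u x :
  (forall i, dot u (row i M) = 0) -> (x <= M)%MS -> dot u x = 0.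
Proof.
move=> uM /row_expand[c ->]; rewrite dot_sumr big1// => i _.
by rewrite dotZr uM mulr0.
Qed.

End Dimension.

Section Facets.
Variables (R : realType) (n : nat) (I : finType).
Variables (a : I -> 'rV[R]_n) (b : I -> R).
Implicit Types (u x y q : 'rV[R]_n) (Q G : set 'rV[R]_n).
Local Notation P := (polyhedron a b).
Local Notation tight := (tight a b).

(** A constraint is tight at a midpoint only if it is tight at both ends, so midpoints shrink the
    tight set until it is least: [q] plays the role of a relative interior point of [Q]. *)
Lemma min_tight Q : Q `<=` P -> Q !=set0 ->
  (forall x y, Q x -> Q y -> Q (2^-1 *: (x + y))) ->
  exists2 q, Q q & forall y, Q y -> tight q \subset tight y.
Proof.
move=> QP [x0 Qx0] Qmid; move: {2}_.+1 (ltnSn #|tight x0|) => k.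
elim: k x0 Qx0 => // k IH x Qx; rewrite ltnS => xk.
have [h|/existsNP[y /not_implyP[Qy /negP xy]]] :=
  pselect (forall y, Q y -> tight x \subset tight y); first by exists x.
apply: (IH _ (Qmid _ _ Qx Qy)); apply: leq_trans xk; apply: proper_card.
have both i : i \in tight (2^-1 *: (x + y)) -> i \in tight x /\ i \in tight y.
  move=> /tightP; rewrite !dot_simp => e.
  by have := QP _ Qx i; have := QP _ Qy i => iy ix; split; apply/tightP; lra.
rewrite properE; apply/andP; split; first by apply/fintype.subsetP => i /both[].
move/fintype.subsetPn: xy => [i ix iy]; apply/fintype.subsetPn; exists i => //.
by apply: contra iy => /both[].
Qed.

Lemma face_in_mid u x y : face_in P u x -> face_in P u y ->
  face_in P u (2^-1 *: (x + y)).
Proof.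
move=> [Px ux] [Py uy]; split; last by rewrite !dot_simp; lra.
by move=> i; rewrite !dot_simp; have := Px i; have := Py i; lra.
Qed.

Lemma polyhedron_mid x y : P x -> P y -> P (2^-1 *: (x + y)).
Proof. by move=> Px Py i; rewrite !dot_simp; have := Px i; have := Py i; lra. Qed.

(** Some constraint is tight at a relative interior point of [G] but not at one of [P]. It is
    constant on [G], and since [G] has codimension one in [P], it cuts out of the affine hull of [P]
    exactly that of [G], where [u] is constant too. *)
Lemma facet_tight G : no_recession a -> facet P G ->
  exists2 i, G = [set x | P x /\ dot (a i) x = b i]
           & exists2 x, P x & dot (a i) x != b i.
Proof.
move=> nr [fG [d [dP dG]]].
have [g Gg] : G !=set0 by have [p [M [Gp _ _ _]]] := dG; exists p.
case: fG Gg => [->//|[u Gu]] Gg.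
have GP : G `<=` P by rewrite Gu => x [].
have [q Gq qmin] : exists2 q, G q & forall y, G y -> tight q \subset tight y.
  by apply: min_tight => //; [exists g|rewrite Gu; exact: face_in_mid].
have [p Pp pmin] := min_tight (fun _ => id) (ex_intro _ g (GP _ Gg)) polyhedron_mid.
have [qp|/fintype.subsetPn[i iq ip]] := boolP (tight q \subset tight p).
  exfalso; suff PG : P `<=` G by have := has_dim_le PG dP dG; rewrite ltnn.
  move=> x Px; have Pq := GP _ Gq.
  (* Here [q] would be relatively interior to [P]: going from [x] slightly beyond [q] stays in [P],
     so minimality of [u] at [q] forces it at [x]. *)
  have [|e e0 /(_ e)] := @small_step _ _ _ a b q (q - x) Pq.
    move=> i iq; rewrite dotBr (tightP _ _ _ _ iq) (tightP a b x i _) ?subrr//.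
    exact: (fintype.subsetP (pmin _ Px)) _ (fintype.subsetP qp _ iq).
  rewrite lexx ltW// => /(_ isT) Pe.
  move: Gq; rewrite Gu => -[_ uq]; split => //.
  have := supp_le u nr Pe; rewrite !dot_simp -uq => h.
  have : supp P u <= dot u x := supp_le u nr Px.
  by rewrite uq in h * => h2; nra.
have aiG y : G y -> dot (a i) y = b i.
  by move=> /qmin/fintype.subsetP/(_ i iq)/tightP.
have [x Px xi] : exists2 x, P x & dot (a i) x != b i.
  by exists p => //; apply: contra ip => /eqP h; apply/tightP.
exists i; last by exists x.
apply/seteqP; split=> [y Gy|y [Py yi]]; first by split; [exact: GP|exact: aiG].
have [p1 [M1 [Gp1 M1f GM1 G1]]] := dG; have [p2 [M2 [_ M2f PM2 P2]]] := dP.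
have M12 : (M1 <= M2)%MS := directions_sub GP Gp1 GM1 P2.
have supG z : G z -> dot u z = supp P u by rewrite Gu => -[].
have uM1 j : dot u (row j M1) = 0.
  by have := supG _ (GM1 j); rewrite dotDr (supG _ Gp1); lra.
have aM1 j : dot (a i) (row j M1) = 0.
  by have := aiG _ (GM1 j); rewrite dotDr (aiG _ Gp1); lra.
have [yM1|yM1] := boolP (y - p1 <= M1)%MS.
  rewrite Gu; split=> //; have := dot_row_space uM1 yM1.
  by rewrite dotBr (supG _ Gp1); lra.
exfalso; move/negP: xi; apply; apply/eqP.
have yM2 : (y - p1 <= M2)%MS.
  have -> : y - p1 = (y - p2) - (p1 - p2) by rewrite opprB addrA subrK.
  by rewrite addmx_sub ?eqmx_opp// P2//; exact: GP.
(* By dimension, one direction outside [M1] generates together with [M1] all directions of [P]; then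
   [a i] is constant on [P], contrary to the choice of [x]. *)
have M2M : (M2 <= M1 + (y - p1))%MS.
  have sub : (M1 + (y - p1) <= M2)%MS by rewrite addsmx_sub M12.
  rewrite -(geq_leqif (mxrank_leqif_sup sub)) (eqP M2f).
  have : (M1 < M1 + (y - p1))%MS.
    rewrite /ltmx addsmxSl/=; apply: contra yM1; apply: submx_trans.
    exact: addsmxSr.
  by rewrite ltmxErank => /andP[_]; rewrite (eqP M1f).
have : (x - p1 <= M1 + (y - p1))%MS.
  have -> : x - p1 = (x - p2) - (p1 - p2) by rewrite opprB addrA subrK.
  apply: submx_trans M2M; rewrite addmx_sub ?eqmx_opp// P2//; exact: GP.
move=> /sub_addsmxP[[w1 w2] /= xE].
have : dot (a i) (x - p1) = 0.
  rewrite xE dotDr (dot_row_space aM1 (submxMl _ _)) add0r.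
  apply: (@dot_row_space _ _ _ (y - p1)); last exact: submxMl.
  by move=> j; rewrite ord1 row_id; rewrite dotBr yi (aiG _ Gp1) subrr.
by rewrite dotBr (aiG _ Gp1) => /eqP; rewrite subr_eq0 => /eqP.
Qed.

End Facets.

Section Bounded.
Variables (R : realType) (n : nat) (I : finType).
Variables (a : I -> 'rV[R]_n) (b : I -> R).
Implicit Types (u x y q : 'rV[R]_n) (Q G : set 'rV[R]_n).
Local Notation P := (polyhedron a b).
Local Notation tight := (tight a b).

Lemma bounded_no_recession : P !=set0 ->
  (exists M, forall x, P x -> forall i, `|x 0 i| <= M) -> no_recession a.
Proof.
move=> [x Px] [M PM] d d0; apply: contrapT => nd.
have {}nd i : 0 <= dot (a i) d by rewrite leNgt; apply/negP => h; apply: nd; exists i.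
have Pt t : 0 <= t -> P (x + t *: d).
  by move=> t0 i; rewrite !dot_simp; apply: le_trans (Px i) _; rewrite lerDl mulr_ge0.
have [j dj] : exists j, d 0 j != 0.
  apply: contrapT => h; move/negP: d0; apply; apply/eqP/rowP => j; rewrite mxE.
  by apply/eqP/negPn/negP => dj; apply: h; exists j.
have M0 : 0 <= M by apply: le_trans (PM _ Px j).
have t0 : 0 <= (2 * M + 1) / `|d 0 j| by rewrite divr_ge0//; lra.
have := PM _ (Pt _ t0) j; rewrite !mxE leNgt => /negP; apply.
rewrite addrC; apply: lt_le_trans (lerB_normD _ _); rewrite normrM ger0_norm//.
rewrite divfK ?normr_eq0//; have := PM _ Px j; lra.
Qed.

(** For the rationality of the affine span: the constraints tight at a relative interior point [q]
    are equations on [P] with integral normals, and the line from [q] to any solution of them starts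
    with a short piece inside [P]. *)
Lemma integral_polytope : (forall i, integral_vec (a i)) -> P !=set0 ->
  (exists M, forall x, P x -> forall i, `|x 0 i| <= M) -> polytope P.
Proof.
move=> aint P0 Pbd; have nr := bounded_no_recession P0 Pbd; split => //.
- exists #|I|, (fun k => a (enum_val k)), (fun k => b (enum_val k)).
  by apply/seteqP; split=> x h i; [exact: h|have := h (enum_rank i); rewrite enum_rankK].
- have [q Pq qmin] := min_tight (fun _ => id) P0 (@polyhedron_mid _ _ _ a b).
  apply/seteqP; split=> x.
    move=> [k [p [c [Pp c1 ->]]]] w y wint wl Py.
    rewrite dot_sumr -[RHS]mul1r -c1 mulr_suml; apply: eq_bigr => i _.
    by rewrite dotZr (wl _ y).
  move=> xh; have xq i : i \in tight q -> dot (a i) (x - q) = 0.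
    move=> iq; rewrite dotBr (xh (a i) q) ?subrr//.
    move=> y z /qmin/fintype.subsetP/(_ i iq)/tightP ->.
    by move=> /qmin/fintype.subsetP/(_ i iq)/tightP ->.
  have [|e e0 /(_ e)] := @small_step _ _ _ a b q (x - q) Pq; first by move=> i /xq ->.
  rewrite lexx ltW// => /(_ isT) Pe.
  exists 2%N, (fun i => if i == ord0 then q + e *: (x - q) else q).
  exists (fun i => if i == ord0 then e^-1 else 1 - e^-1); split.
  + by move=> i; case: ifP.
  + by rewrite !big_ord_recl big_ord0/=; lra.
  rewrite !big_ord_recl big_ord0/= addr0; apply/rowP => j; rewrite !mxE.
  by field; rewrite gt_eqF.
move=> G fG; have [i Gi [x Px xi]] := facet_tight nr fG; exists (a i) => //.
have [_ [d [_ [p [M [Gp _ _ _]]]]]] := fG.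
move: Gp; rewrite Gi => -[Pp pi].
rewrite /face_in (supp_min Pp) ?pi// => y Py; rewrite pi; exact: Py.
Qed.

End Bounded.

(** * Descent along edges and the depth of a face *)

Section EdgeDescent.
Variables (R : realType) (n : nat) (I : finType).
Variables (a : I -> 'rV[R]_n) (b : I -> R).
Hypothesis nr : no_recession a.
Implicit Types (u x y z d : 'rV[R]_n).
Local Notation P := (polyhedron a b).
Local Notation tight := (tight a b).
Local Notation basic := (basic a b).

(** By the last hypothesis the tight constraints orthogonal to [d] leave only the line of [d], so
    they define an edge. The constraint met at the exit is not orthogonal to [d]; it removes this
    last freedom and makes the end point basic. *)
Lemma edge_ray x d : basic x -> d != 0 ->
  (forall i, i \in tight x -> 0 <= dot (a i) d) ->
  (forall d', (forall i, i \in tight x -> dot (a i) d = 0 -> dot (a i) d' = 0) ->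
    exists k, d' = k *: d) ->
  exists t, [/\ 0 < t, basic (x + t *: d)
    & exists E, [/\ edge P E, E x & E (x + t *: d)]].
Proof.
move=> [Px _] d0 xd span; have [i0 i0d] := nr d0.
have [t [t0 Py [j jd jy]]] := ray_exit Px xd i0d; set y := x + t *: d in Py jy *.
pose B := [set i in tight x | dot (a i) d == 0].
have Bx : B \subset tight x by apply/fintype.subsetP => i; rewrite inE => /andP[].
have By : B \subset tight y.
  apply/fintype.subsetP => i; rewrite inE => /andP[/tightP ix /eqP id].
  by apply/tightP; rewrite !dot_simp ix id mulr0 addr0.
exists t; split=> //.
  split=> // d' d'y; have [k d'E] : exists k, d' = k *: d.
    apply: span => i ix id; apply: d'y; apply: (fintype.subsetP By).
    by rewrite inE ix id eqxx.
  have := d'y j jy; rewrite d'E dotZr => /eqP; rewrite mulf_eq0 (lt_eqF jd) orbF.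
  by move=> /eqP ->; rewrite scale0r.
exists (face_in P (\sum_(i in B) a i)); rewrite (face_sum Px Bx); split=> //.
split; first by right; exists (\sum_(i in B) a i); rewrite (face_sum Px Bx).
exists x, (t *: d); split=> //.
- by rewrite /row_free rank_rV scaler_eq0 (gt_eqF t0) (negbTE d0).
- by move=> i; rewrite ord1 row_id.
- move=> z [Pz /fintype.subsetP Bz].
  have [|k ->] := span (z - x).
    move=> i ix id; rewrite dotBr (tightP _ _ _ _ ix) (tightP a b z i _) ?subrr//.
    by apply: Bz; rewrite inE ix id eqxx.
  apply: scalemx_sub.
  by rewrite -[X in (X <= _)%MS](scalerK (lt0r_neq0 t0)); apply: scalemx_sub.
Qed.

(* The slice of the cone of feasible directions at [y] by the sum of the tight
   normals is bounded; an optimal basic point of it spans an edge of [P]. *)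
Lemma edge_descent u x y : basic y -> P x -> dot u x < dot u y ->
  exists z E, [/\ basic z, edge P E, E y, E z & dot u z < dot u y].
Proof.
move=> [Py ysp] Px uxy; pose A := tight y; pose u0 := \sum_(i in A) a i.
have zero d : (forall i, i \in A -> 0 <= dot (a i) d) -> dot u0 d = 0 -> d = 0.
  rewrite dot_suml => h /psumr_eq0P h0; apply: ysp => i iA; exact: h0.
(* Constraints not tight at [y] become void, which keeps the index type independent of [y]. *)
pose aQ (i : I + bool) := match i with
  | inl i => if i \in A then a i else 0
  | inr s => if s then u0 else - u0 end.
pose bQ (i : I + bool) : R := match i with
  | inl i => 0 | inr s => if s then 1 else -1 end.
have aQl i d : i \in A -> dot (aQ (inl i)) d = dot (a i) d by move=> /= ->.
have QP d : polyhedron aQ bQ d ->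
    (forall i, i \in A -> 0 <= dot (a i) d) /\ dot u0 d = 1.
  move=> Qd; split; first by move=> i iA; have := Qd (inl i); rewrite aQl.
  by have := Qd (inr true); have := Qd (inr false); rewrite /= dotNl; lra.
have nrQ : no_recession aQ.
  move=> d d0; have [u0d|u0d|u0d] := ltgtP (dot u0 d) 0.
  - by exists (inr true).
  - by exists (inr false); rewrite /= dotNl oppr_lt0.
  apply: contrapT => h; move/negP: d0; apply; apply/eqP; apply: zero => // i iA.
  by rewrite leNgt; apply/negP => ia; apply: h; exists (inl i); rewrite aQl.
have d0A i : i \in A -> 0 <= dot (a i) (x - y).
  by move=> /tightP iy; rewrite dotBr iy subr_ge0; exact: Px.
have d0pos : 0 < dot u0 (x - y).
  rewrite lt_neqAle; apply/andP; split; last by rewrite dot_suml sumr_ge0.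
  apply: contraTneq uxy => /esym/(zero _ d0A) /eqP; rewrite subr_eq0 => /eqP ->.
  by rewrite ltxx.
have Qd1 : polyhedron aQ bQ ((dot u0 (x - y))^-1 *: (x - y)).
  case=> [i|[]] /=; rewrite dotZr.
  - by case: ifP => [iA|_]; rewrite ?dot0l ?mulr0// mulr_ge0 ?invr_ge0 ?(ltW d0pos)// d0A.
  - by rewrite mulVf// gt_eqF.
  - by rewrite dotNl mulrN mulVf// gt_eqF.
have [d [[Qd dsp] ud _]] := to_basic u nrQ Qd1.
have [dA u0d] := QP _ Qd.
have {}ud : dot u d < 0.
  apply: le_lt_trans ud _; rewrite dotZr pmulr_rlt0 ?invr_gt0// dotBr; lra.
(* The difference of the two sides is parallel to the slice and annihilated by all constraints tight
   at [d]; it vanishes because [d] is basic in the slice. *)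
have span d' : (forall i, i \in A -> dot (a i) d = 0 -> dot (a i) d' = 0) ->
    d' = dot u0 d' *: d.
  move=> d'A; apply/eqP; rewrite -subr_eq0; apply/eqP; apply: dsp => -[i|s] /tightP.
    move=> /=; case: ifP => [iA|_ _]; last by rewrite dot0l.
    by move=> id; rewrite !dot_simp d'A// id mulr0 subr0.
  by case: s => /= _; rewrite !dot_simp u0d mulr1; lra.
have dn0 : d != 0 by apply: contraTneq ud => ->; rewrite dot0r ltxx.
have [t [t0 bz [E [eE Ey Ez]]]] := edge_ray (conj Py ysp) dn0 dA
  (fun d' h => ex_intro _ _ (span d' h)).
exists (y + t *: d), E; split=> //.
by rewrite !dot_simp gtrDl pmulr_rlt0.
Qed.

(** Take a lowest vertex [y] off [F]. An edge descends from it, and its other end lies in [F] by the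
    choice of [y]. So [y] is a neighbor, and the minimum over the neighbors is the one over all
    vertices off [F]. *)
Lemma depth_attained F u y0 : F = face_in P u -> P y0 -> ~ F y0 ->
  exists y, [/\ basic y, ~ F y, neighbor P F y, depth P F u = dot u y - supp P u
    & forall v, basic v -> ~ F v -> dot u y <= dot u v].
Proof.
move=> Fu Py0 Fy0; have [x0 [bx0 x0min]] := supp_attained u nr (ex_intro _ y0 Py0).
have [Px0 _] := bx0; have Fx0 : F x0 by rewrite Fu; exact: face_in_min.
have sx0 : supp P u = dot u x0 := supp_min Px0 x0min.
have [s sP] := basic_seq a b.
pose s' := [seq v <- s | `[< ~ F v >]].
have s'P v : v \in s' <-> basic v /\ ~ F v.
  rewrite mem_filter; split=> [/andP[/asboolP ? /sP]//|[/sP vs Fv]].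
  by apply/andP; split=> //; exact/asboolP.
have [v0 v0s] : exists v, v \in s'.
  apply: contrapT => h.
  (* If all vertices were in [F], one at least as high as [y0] would be, which puts [y0] itself at
     the minimum of [u]. *)
  have sF v : basic v -> F v.
    by move=> bv; apply: contrapT => Fv; apply: h; exists v; apply/s'P.
  have [w [bw wy _]] := to_basic (- u) nr Py0; apply: Fy0; rewrite Fu; split=> //.
  have := sF _ bw; rewrite Fu => -[_ uw]; apply/eqP; rewrite eq_le supp_le// andbT -uw.
  by move: wy; rewrite !dotNl lerN2.
have [y /s'P[bYy Fy] ymin] := seq_min (dot u) v0s.
have {}ymin v : basic v -> ~ F v -> dot u y <= dot u v by move=> bv Fv; apply/ymin/s'P.
have ux0y : dot u x0 < dot u y.
  rewrite ltNge; apply/negP => h; apply: Fy; rewrite Fu; have [Py _] := bYy; split=> //.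
  by apply/eqP; rewrite eq_le supp_le// sx0 h.
have [z [E [bz eE Ey Ez zy]]] := edge_descent bYy Px0 ux0y.
have Fz : F z by apply: contrapT => /(ymin _ bz); rewrite leNgt zy.
have nby : neighbor P F y.
  split=> //; first exact/basic_vertex.
  by exists z, E; split=> //; exact/basic_vertex.
exists y; split=> //; apply/eqP; rewrite eq_le; apply/andP; split.
  apply: ge_inf; last by exists y.
  exists 0 => _ [v [vv _ _] <-]; rewrite subr_ge0 supp_le//.
  by have /basic_vertex-/(_ nr)[] := vv.
apply: lb_le_inf; first by exists (dot u y - supp P u), y.
move=> _ [v [vv Fv _] <-]; rewrite lerB// ymin//.
exact/basic_vertex.
Qed.

Lemma depth_le F u v : F = face_in P u -> vertex P v -> ~ F v ->
  depth P F u <= dot u v - supp P u.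
Proof.
move=> Fu /(basic_vertex b _ nr) bv Fv.
have [y [_ _ _ -> ymin]] := depth_attained Fu (proj1 bv) Fv.
by rewrite lerB// ymin.
Qed.

Lemma depth_gt0 F u y : F = face_in P u -> P y -> ~ F y -> 0 < depth P F u.
Proof.
move=> Fu Py Fy; have [z [[Pz _] Fz _ -> _]] := depth_attained Fu Py Fy.
rewrite subr_gt0 lt_neqAle supp_le// andbT; apply/eqP => h.
by apply: Fz; rewrite Fu.
Qed.

End EdgeDescent.

(** An empty face has no neighbors, and [inf] of the empty set is [0] by default. *)
Lemma depth_gt0_meets (R : realType) (n : nat) (P F : set 'rV[R]_n) u :
  0 < depth P F u -> F !=set0.
Proof.
move=> d0; apply: contrapT => F0; move: d0; rewrite /depth.
rewrite (_ : [set _ | _ in _] = set0) ?inf0 ?ltxx//.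
apply/seteqP; split=> // t [y [_ _ [v [E [_ Fv _ _ _]]]] _].
by case: F0; exists v.
Qed.

(** * Facet description of a simple polytope *)

Section Slice.
Variables (R : realType) (n : nat) (K : Type).
Variables (w : 'rV[R]_n) (c : R) (a : K -> 'rV[R]_n) (b : K -> R).

(* The equation [w.x = c] is the pair of constraints indexed by [inl]. *)
Definition slice_normal (i : bool + K) : 'rV[R]_n :=
  match i with inl s => if s then w else - w | inr k => a k end.

Definition slice_offset (i : bool + K) : R :=
  match i with inl s => if s then c else - c | inr k => b k end.

End Slice.

Section SliceTheory.
Variables (R : realType) (n : nat) (K : finType).
Variables (w : 'rV[R]_n) (c : R) (a : K -> 'rV[R]_n) (b : K -> R).
Implicit Types (x y d : 'rV[R]_n).
Local Notation sn := (slice_normal w a).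
Local Notation so := (slice_offset c b).

Lemma polyhedron_slice :
  polyhedron sn so = [set x | dot w x = c /\ forall k, b k <= dot (a k) x].
Proof.
apply/seteqP; split=> x /= h.
  split; last by move=> k; exact: (h (inr k)).
  by have := h (inl true); have := h (inl false); rewrite /= dotNl; lra.
by case: h => wx ax [[]|k] /=; rewrite ?dotNl ?wx.
Qed.

Lemma slice_tight x k : (inr k \in tight sn so x) = (dot (a k) x == b k).
Proof. by rewrite inE. Qed.

Lemma slice_tightW x s : dot w x = c -> inl s \in tight sn so x.
Proof. by move=> wx; rewrite inE /=; case: s; rewrite ?dotNl wx. Qed.

Lemma slice_small_step x d : polyhedron sn so x -> dot w d = 0 ->
  (forall k, dot (a k) x = b k -> 0 <= dot (a k) d) ->
  exists2 e, 0 < e & forall t, 0 <= t <= e -> polyhedron sn so (x + t *: d).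
Proof.
move=> Px wd ad; apply: small_step => // -[s _|k].
  by case: s; rewrite /= ?dotNl wd ?oppr0.
by rewrite slice_tight => /eqP /ad.
Qed.

Lemma slice_basic x : polyhedron sn so x ->
  (forall d, dot w d = 0 -> (forall k, dot (a k) x = b k -> dot (a k) d = 0) -> d = 0) ->
  basic sn so x.
Proof.
move=> Px sp; split=> // d xd.
have wx : dot w x = c by move: Px; rewrite polyhedron_slice => -[].
apply: sp => [|k ak]; first exact: (xd _ (slice_tightW true wx)).
by apply: (xd (inr k)); rewrite slice_tight ak.
Qed.

Lemma basic_slice x : basic sn so x ->
  forall d, dot w d = 0 -> (forall k, dot (a k) x = b k -> dot (a k) d = 0) -> d = 0.
Proof.
move=> [_ sp] d wd xd; apply: sp => -[s _|k].
  by case: s; rewrite /= ?dotNl wd ?oppr0.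
by rewrite slice_tight => /eqP /xd.
Qed.

End SliceTheory.

Section FacetDescription.
Variables (R : realType) (m : nat).
Local Notation V := 'rV[R]_(m.+1).
Variable S : set V.
Hypotheses (S_dim : has_dim S m) (S_simple : simple_polytope S).
Hypothesis S_notlinear : ~ aff_span S 0.

Lemma in_directions (M : 'M[R]_(m, m.+1)) w x : row_free M -> w != 0 ->
  (forall i, dot w (row i M) = 0) -> dot w x = 0 -> (x <= M)%MS.
Proof.
move=> Mf w0 wM wx.
have kE (k : nat) (A : 'M[R]_(k, m.+1)) : (forall i, dot w (row i A) = 0) ->
    (A <= kermx w^T)%MS.
  move=> wA; apply/sub_kermxP/matrixP => i j; rewrite ord1 [RHS]mxE -(wA i).
  by rewrite !mxE; apply: eq_bigr => l _; rewrite !mxE mulrC.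
have MK := kE _ _ wM; apply: (submx_trans (kE _ x _)).
  by move=> i; rewrite ord1 row_id.
rewrite -(geq_leqif (mxrank_leqif_sup MK)) mxrank_ker mxrank_tr rank_rV w0 (eqP Mf).
by rewrite subn1.
Qed.

(** Were [0] the only integral vector in the lineality space, [rational_span] would make the affine
    span the whole space. So there is a nonzero integral [w]; its constant [c] is nonzero, as
    otherwise [0] would lie in the affine span. *)
Lemma affine_hull_eq : exists w c, [/\ integral_vec w, w != 0, c != 0,
  forall x, S x -> dot w x = c
  & forall x, dot w x = c -> aff_span S x].
Proof.
have [p [M [Sp Mf SM MS]]] := S_dim.
have [[_ _ _ rat _] _] := S_simple.
have [w [wi wl w0]] : exists w, [/\ integral_vec w, lineality S w & w != 0].
  apply: contrapT => h; apply: S_notlinear; rewrite rat => w y wi wl Sy.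
  have /eqP -> : w == 0 by apply/negPn/negP => w0; apply: h; exists w.
  by rewrite !dot0l.
have hull x : dot w x = dot w p -> aff_span S x.
  move=> wx; have /row_expand[c xc] : (x - p <= M)%MS.
    apply: (in_directions Mf w0); last by rewrite dotBr wx subrr.
    by move=> i; rewrite -[row i M](addKr p) dotDr dotNr (wl _ _ (SM i) Sp) addrC subrr.
  exists m.+1, (fun i => if unlift ord0 i is Some j then p + row j M else p).
  exists (fun i => if unlift ord0 i is Some j then c j else 1 - \sum_j c j); split.
  - by move=> i; case: unlift.
  - rewrite big_ord_recl unlift_none; rewrite [X in _ + X](eq_bigr c) ?subrK// => j _.
    by rewrite liftK.
  - rewrite big_ord_recl unlift_none.
    rewrite [X in _ + X](eq_bigr (fun j => c j *: p + c j *: row j M)).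
    rewrite big_split/= -xc -scaler_suml addrA -scalerDl subrK scale1r.
    by rewrite addrC subrK.
    by move=> j _; rewrite liftK scalerDr.
exists w, (dot w p); split=> //; last by move=> x Sx; exact: wl.
apply/eqP => wp; apply: S_notlinear; apply: hull; by rewrite dot0r.
Qed.

End FacetDescription.

Section Irredundant.
Variables (R : realType) (m : nat).
Local Notation V := 'rV[R]_(m.+1).
Variables (S : set V) (w : V) (c : R).
Hypotheses (S_dim : has_dim S m) (w0 : w != 0) (wS : forall x, S x -> dot w x = c).

Lemma dim_directions w' p (M : 'M[R]_(m, m.+1)) : S p -> row_free M ->
  (forall i, S (p + row i M)) -> (forall i, dot w' (row i M) = 0) ->
  forall d, dot w d = 0 -> dot w' d = 0.
Proof.
move=> Sp Mf SM wM d wd; apply: (dot_row_space wM); apply: (in_directions Mf w0) => //.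
by move=> i; have := wS (SM i); rewrite dotDr wS//; lra.
Qed.

(** [J] is a minimal set of constraints that cut out [S] within its affine hull. By minimality some
    [x] violates [j] alone, and the segment from the interior point [p] to [x] meets the hyperplane
    of [j] in [q]. *)
Lemma irredundant (I : finType) (a : I -> V) (b : I -> R) : S = polyhedron a b ->
  exists (J : {set I}) p, [/\ S p,
    forall j, j \in J -> b j < dot (a j) p,
    S = [set x | dot w x = c /\ forall j, j \in J -> b j <= dot (a j) x]
  & forall j, j \in J -> exists q, [/\ S q, dot (a j) q = b j &
      forall i, i \in J -> i != j -> b i < dot (a i) q]].
Proof.
move=> SE; have [p0 [M [Sp0 Mf SM MS]]] := S_dim.
have [p Sp pmin] : exists2 q, S q & forall y, S y -> tight a b q \subset tight a b y.
  by apply: min_tight; [rewrite SE|exists p0|rewrite SE; exact: polyhedron_mid].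
pose Q (J : {set I}) := `[< S = [set x | dot w x = c /\ forall j, j \in J -> b j <= dot (a j) x] >].
have Q0 : Q (~: tight a b p).
  apply/asboolP/seteqP; split=> x.
    by move=> Sx; split; [exact: wS|move=> j _; move: Sx; rewrite SE; exact].
  move=> [wx ax]; rewrite SE => i; have [ip|ip] := boolP (i \in tight a b p); last first.
    by apply: ax; rewrite finset.in_setC.
  (* A constraint tight at [p] is an equation on [S], hence it holds on the whole hyperplane
     [dot w x = c]. *)
  have ti y : S y -> dot (a i) y = b i.
    by move=> Sy; apply/tightP; exact: (fintype.subsetP (pmin _ Sy)).
  have : dot (a i) (x - p0) = 0.
    apply: (dim_directions Sp0 Mf SM); last by rewrite dotBr wx wS// subrr.
    by move=> j; have := ti _ (SM j); rewrite dotDr ti//; lra.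
  by rewrite dotBr (ti _ Sp0) => /eqP; rewrite subr_eq0 => /eqP ->.
have [J /minsetP[/asboolP QJ Jmin] JC] := minset_exists Q0.
have Jp j : j \in J -> b j < dot (a j) p.
  move=> /(fintype.subsetP JC); rewrite finset.in_setC => jp.
  by apply: not_tight_lt => //; rewrite -SE.
exists J, p; split=> // j jJ.
have [x [wx xJ xj]] : exists x, [/\ dot w x = c,
    forall i, i \in J -> i != j -> b i <= dot (a i) x & dot (a j) x < b j].
  apply: contrapT => h.
  have : Q (J :\ j).
    apply/asboolP; rewrite [LHS]QJ; apply/seteqP; split=> x [wx xJ]; split=> // i.
      by rewrite in_setD1 => /andP[_ /xJ].
    have [-> _|ij iJ] := eqVneq i j; last by apply: xJ; rewrite in_setD1 ij.
    rewrite leNgt; apply/negP => xj; apply: h; exists x; split=> // k kJ kj.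
    by apply: xJ; rewrite in_setD1 kj.
  move=> /Jmin /(_ (subD1set _ _)) /setP/(_ j).
  by rewrite in_setD1 eqxx jJ.
have pj := Jp _ jJ.
pose t := (dot (a j) p - b j) / (dot (a j) p - dot (a j) x).
have D0 : 0 < dot (a j) p - dot (a j) x by lra.
have t0 : 0 < t by rewrite divr_gt0// subr_gt0.
have t1 : t < 1 by rewrite ltr_pdivrMr//; lra.
have qj : dot (a j) (p + t *: (x - p)) = b j.
  by rewrite !dot_simp /t; field; rewrite gt_eqF.
have qi i : i \in J -> i != j -> b i < dot (a i) (p + t *: (x - p)).
  by move=> iJ ij; rewrite !dot_simp; have := Jp _ iJ; have := xJ _ iJ ij; nra.
exists (p + t *: (x - p)); split=> //; rewrite QJ; split.
  by rewrite !dot_simp wx wS//; ring.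
move=> i iJ; have [->|ij] := eqVneq i j; first by rewrite qj.
by apply/ltW/qi.
Qed.

End Irredundant.

Section FacetNormals.
Variables (R : realType) (m : nat).
Local Notation V := 'rV[R]_(m.+1).
Variables (S : set V) (uG : set V -> V).
Hypotheses (S_dim : has_dim S m) (S_simple : simple_polytope S).
Hypotheses (S_notlinear : ~ aff_span S 0) (uG_normals : facet_normals S uG).

(** Only [j] is tight at [q], so [q] can move a little in every direction orthogonal to [w] and
    [a j]. These two are independent, since [a j] separates [p] from [q] while [w] is nonzero and
    does not. *)
Lemma hyperplane_section_dim (I : finType) (w : V) c (a : I -> V) b j q p :
  w != 0 -> S = polyhedron (slice_normal w a) (slice_offset c b) ->
  S p -> b j < dot (a j) p -> S q -> dot (a j) q = b j ->
  (forall i, i != j -> b i < dot (a i) q) ->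
  facet S [set x | S x /\ dot (a j) x = b j].
Proof.
move=> w0 SE Sp pj Sq qj qi.
have Sa x : S x -> b j <= dot (a j) x by rewrite SE polyhedron_slice => -[].
have Sw x : S x -> dot w x = c by rewrite SE polyhedron_slice => -[].
have supj : supp S (a j) = b j by rewrite (supp_min Sq) // => y Sy; rewrite qj; exact: Sa.
pose A : 'M[R]_(1 + 1, m.+1) := col_mx w (a j).
have Afree : row_free A.
  apply: inj_row_free => v; rewrite -[v]hsubmxK mul_row_col.
  set l := lsubmx v; set r := rsubmx v => lr0.
  have E (y : V) : l 0 0 * dot w y + r 0 0 * dot (a j) y = 0.
    rewrite -!dotZl -dotDl -[RHS](dot0l y) -lr0; congr (dot (_ + _) _).
      by rewrite [l in RHS]mx11_scalar mul_scalar_mx.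
    by rewrite [r in RHS]mx11_scalar mul_scalar_mx.
  have r0 : r 0 0 = 0.
    have := E (p - q); rewrite !dotBr (Sw p)// (Sw q)// qj; nra.
  have l0 : l 0 0 = 0.
    by have := E w; rewrite r0; have := dot_self_gt0 w0; nra.
  by rewrite [l]mx11_scalar [r]mx11_scalar l0 r0 !raddf0 row_mx0.
pose D := row_base (kermx A^T).
have DE x : (x <= D)%MS = (dot w x == 0) && (dot (a j) x == 0).
  rewrite eq_row_base sub_kermx; apply/eqP/andP.
    move=> /(congr1 trmx); rewrite trmx_mul trmxK trmx0 /A mul_col_mx => h.
    split; apply/eqP; rewrite dotE.
      by rewrite -[_ *m _](col_mxKu _ (a j *m x^T)) h mxE mxE.
    by rewrite -[_ *m _](col_mxKd (w *m x^T) _) h mxE mxE.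
  move=> [/eqP wx /eqP ax]; apply: trmx_inj; rewrite trmx_mul trmxK trmx0 /A mul_col_mx.
  have M0 u : dot u x = 0 -> u *m x^T = 0.
    by move=> ux; apply/matrixP => i k; rewrite !ord1 -dotE ux mxE.
  by rewrite !M0// col_mx0.
have rkD : (\rank (kermx A^T)).+1 = m.
  have := rank_leq_col A; rewrite (eqP Afree) => m1.
  by rewrite mxrank_ker mxrank_tr (eqP Afree) subSS subn1 prednK.
have [e e0 eS] : exists2 e, 0 < e & forall t, 0 <= t <= e ->
    forall i, S (q + t *: row i D).
  apply: (@fin_small _ _ (fun i t => S (q + t *: row i D))) => i.
  have : (row i D <= D)%MS by exact: row_sub.
  rewrite DE => /andP[/eqP wi /eqP ai]; rewrite SE; apply: slice_small_step => //.
    by rewrite -SE.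
  move=> k; have [->|kj] := eqVneq k j; first by rewrite ai.
  by move=> kq; have := qi _ kj; rewrite kq ltxx.
split.
  by right; exists (a j); rewrite /face_in supj.
exists (\rank (kermx A^T)); split; first by rewrite rkD.
exists q, (e *: D); split=> //.
- by rewrite /row_free mxrank_scale_nz ?(lt0r_neq0 e0)//; exact: row_base_free.
- move=> i; rewrite linearZ/=; split; first by apply: eS; rewrite lexx ltW.
  have : (row i D <= D)%MS by exact: row_sub.
  by rewrite DE => /andP[_ /eqP ai]; rewrite !dot_simp ai mulr0 addr0.
move=> x [Sx xj]; rewrite (eqmx_scale D (lt0r_neq0 e0)) DE !dotBr.
by rewrite xj qj !Sw// !subrr eqxx.
Qed.

(** A polytope comes with arbitrary real constraint normals. They are traded for the integral
    normals [uG], which bound the same halfspaces inside the hyperplane of [S]. *)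
Lemma facet_description : exists (J : finType) (G : J -> set V) (w : V) (c : R),
  [/\ integral_vec w /\ c != 0, injective G,
      forall H, facet S H <-> exists j, H = G j,
      S = [set x | dot w x = c /\ forall j, supp S (uG (G j)) <= dot (uG (G j)) x]
    & forall v, vertex S v -> #|[set j | `[< G j v >]]| = m].
Proof.
have [w [c [wi w0 c0 wS hull]]] := affine_hull_eq S_dim S_simple S_notlinear.
have [[_ [k [a [b SE]]] Sbd _ _] [d Sd facetd]] := S_simple.
have [J [p [Sp Jp SJ Jq]]] := irredundant S_dim w0 wS SE.
pose K : finType := {i : 'I_k | i \in J}.
pose aK (j : K) := a (val j); pose bK (j : K) := b (val j).
have SP : S = polyhedron (slice_normal w aK) (slice_offset c bK).
  rewrite polyhedron_slice [LHS]SJ; apply/seteqP; split=> x [wx ax]; split=> // j.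
    by apply: ax; exact: (valP j).
  by move=> jJ; exact: (ax (Sub j jJ)).
have {}Jp j : bK j < dot (aK j) p by apply: Jp; exact: (valP j).
have {}Jq j : exists q, [/\ S q, dot (aK j) q = bK j & forall i, i != j -> bK i < dot (aK i) q].
  have [q [Sq qj qi]] := Jq _ (valP j); exists q; split=> // i ij.
  by apply: qi; [exact: (valP i)|rewrite (inj_eq val_inj)].
have nr : no_recession (slice_normal w aK).
  by apply: (@bounded_no_recession _ _ _ _ (slice_offset c bK)); rewrite -SP//; exists p.
pose G j := [set x | S x /\ dot (aK j) x = bK j].
have Gfacet j : facet S (G j).
  by have [q [Sq qj qi]] := Jq j; apply: (hyperplane_section_dim w0 SP Sp _ Sq).
have Ginj : injective G.
  move=> i j Gij; have [q [Sq qj qi]] := Jq i; apply/eqP/negPn/negP => ij.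
  have [_] : G j q by rewrite -Gij.
  by have := qi j; rewrite eq_sym ij => /(_ isT) h e; rewrite e ltxx in h.
have facetG H : facet S H <-> exists j, H = G j.
  split=> [|[j ->]//]; rewrite SP => /facet_tight-/(_ nr)[i]; rewrite -SP.
  case: i => [s _ [x Sx]|j -> _]; last by exists j.
  have : inl s \in tight (slice_normal w aK) (slice_offset c bK) x.
    by apply: slice_tightW; exact: wS.
  by rewrite inE => /eqP ->; rewrite eqxx.
exists K, G, w, c; split=> //.
  have Slb u x : S x -> supp S u <= dot u x by rewrite SP; exact: supp_le.
  apply/seteqP; split=> x.
    by move=> Sx; split; [exact: wS|move=> j; exact: Slb].
  move=> [wx ux]; rewrite SP polyhedron_slice; split=> // j; rewrite leNgt; apply/negP => xj.
  set u := uG (G j) in ux; have [_ Gu _] := uG_normals (Gfacet j); rewrite -/u in Gu.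
  have [q [Sq qj qi]] := Jq j.
  (* From [q], where only [j] is tight, one can move along [d'] and along [- d'] inside [G j]. So
     within the hyperplane [u] is a multiple of [aK j]. *)
  have uz d' : dot w d' = 0 -> dot (aK j) d' = 0 -> dot u d' = 0.
    have half d0 : dot w d0 = 0 -> dot (aK j) d0 = 0 -> 0 <= dot u d0.
      move=> wd ad; have [||e e0 /(_ e)] := @slice_small_step _ _ _ w c aK bK q d0 _ wd.
      - by rewrite -SP.
      - move=> i; have [->|ij] := eqVneq i j; first by rewrite ad.
        by move=> iq; have := qi _ ij; rewrite iq ltxx.
      rewrite lexx ltW// -SP => /(_ isT) /(Slb u); rewrite !dot_simp.
      have [_ <-] : face_in S u q by rewrite -Gu.
      by rewrite lerDl pmulr_rge0.
    move=> wd ad; apply/eqP; rewrite eq_le half// andbT -oppr_ge0 -dotNr.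
    by apply: half; rewrite dotNr ?wd ?ad oppr0.
  have up : supp S u < dot u p.
    rewrite lt_neqAle Slb// andbT; apply/negP => /eqP e.
    by have [_] : G j p by [rewrite Gu]; have := Jp j => h e'; rewrite e' ltxx in h.
  have uq : dot u q = supp S u by have [_] : face_in S u q by rewrite -Gu.
  (* At parameter [t] the segment from [p] to [x] crosses the facet hyperplane, where [u] has its
     minimum over [S]; as [u] is larger at [p], it falls below this minimum at [x]. *)
  have pj := Jp j; pose t := (dot (aK j) p - bK j) / (dot (aK j) p - dot (aK j) x).
  have D0 : 0 < dot (aK j) p - dot (aK j) x by lra.
  have t0 : 0 < t by rewrite divr_gt0// subr_gt0.
  have t1 : t < 1 by rewrite ltr_pdivrMr//; lra.
  have tj : dot (aK j) (p + t *: (x - p)) = bK j.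
    by rewrite !dot_simp /t; field; rewrite gt_eqF.
  have : dot u (p + t *: (x - p) - q) = 0.
    apply: uz; last by rewrite dotBr tj qj subrr.
    by rewrite !dot_simp wx !wS//; ring.
  rewrite !dot_simp uq; have := ux j; rewrite -/u; nra.
move=> v /facetd; rewrite (has_dim_uniq Sd S_dim) => fm.
pose A := [set j | `[< G j v >]].
have Aim : (fun i => G (enum_val i)) @` [set: 'I_#|A|] = [set H | facet S H /\ H v].
  apply/seteqP; split=> [_ [i _ <-]|H [/facetG[j ->] Gj]].
    by split=> //; have := enum_valP i; rewrite inE => /asboolP.
  have jA : j \in A by rewrite inE; apply/asboolP.
  by exists (enum_rank_in jA j) => //; rewrite enum_rankK_in.
have := inj_card_eq (A := [set: 'I_#|A|]) (in2W (inj_comp Ginj enum_val_inj)).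
rewrite Aim (card_eql fm) -(card_eqr card_II) => /card_eq_II.
by move=> <-.
Qed.

End FacetNormals.

(** * Simplices and flags *)

Section SimpleSlice.
Variables (R : realType) (m : nat) (J : finType).
Local Notation V := 'rV[R]_(m.+1).
Variables (U : J -> V) (h : J -> R) (w : V) (c : R).
Implicit Types (s t : {set J}) (x y v d u : V) (j : J) (js : 'I_m -> J).

Local Notation S := (polyhedron (slice_normal w U) (slice_offset c h)).

Definition active x : {set J} := [set j | dot (U j) x == h j].

Hypothesis nr : no_recession (slice_normal w U).
Hypothesis card_active :
  forall v, basic (slice_normal w U) (slice_offset c h) v -> #|active v| = m.

Definition normal_sum s : V := \sum_(j in s) U j.
Definition slack s x : R := \sum_(j in s) (dot (U j) x - h j).
(* A simplex is the set of all facets containing some point of [S]: it encodes a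
   nonempty face, with inclusion reversed, and [set0] encodes [S] itself. *)
Definition is_simplex s := exists2 x, S x & active x = s.

Definition flag js v := [/\ basic (slice_normal w U) (slice_offset c h) v,
  injective js & active v = [set js i | i : 'I_m]].
(* The facets of the [k]-th face of the flag: the faces decrease with [k], down to
   the vertex. *)
Definition flag_set js (k : 'I_m) : {set J} := [set js i | i : 'I_m & (i <= k)%N].

Lemma in_slice x : S x <-> dot w x = c /\ forall j, h j <= dot (U j) x.
Proof. by rewrite polyhedron_slice. Qed.

Lemma activeP x j : reflect (dot (U j) x = h j) (j \in active x).
Proof. by rewrite inE; exact: eqP. Qed.

Lemma slackE s x : slack s x = dot (normal_sum s) x - \sum_(j in s) h j.
Proof. by rewrite /slack big_split/= sumrN dot_suml. Qed.

Lemma slackD s x d k : slack s (x + k *: d) = slack s x + k * dot (normal_sum s) d.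
Proof. by rewrite !slackE dotDr dotZr addrAC. Qed.

Lemma slack_ge0 s x : S x -> 0 <= slack s x.
Proof. by move=> /in_slice[_ xh]; apply: sumr_ge0 => j _; rewrite subr_ge0. Qed.

Lemma slack_mono s t x : S x -> s \subset t -> slack s x <= slack t x.
Proof.
move=> /in_slice[_ xh] st; rewrite /slack [leRHS](big_setID s)/= (finset.setIidPr st).
by rewrite lerDl sumr_ge0// => j _; rewrite subr_ge0.
Qed.

Lemma slack_eq0 s x : S x -> slack s x = 0 <-> s \subset active x.
Proof.
move=> Sx; split=> [/psumr_eq0P s0|/fintype.subsetP sx].
  apply/fintype.subsetP => j js; apply/activeP/eqP; rewrite -subr_eq0; apply/eqP.
  by apply: s0 => // i _; have /in_slice[_] := Sx; rewrite subr_ge0.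
by apply: big1 => j /sx/activeP ->; rewrite subrr.
Qed.

Lemma simplex_vertex x : S x ->
  exists2 v, basic (slice_normal w U) (slice_offset c h) v & active x \subset active v.
Proof.
move=> Sx; have [v [bv _ /fintype.subsetP xv]] := to_basic 0 nr Sx; exists v => //.
apply/fintype.subsetP => j jx; have := xv (inr j); rewrite !slice_tight.
by move: jx; rewrite !inE => jx; exact.
Qed.

(** A constant weight [al] gives any flag at [v], an indicator function puts the facets of a given
    simplex first, and the coordinates of a functional lead to a flag whose cone contains it. *)
Lemma flag_exists v (al : J -> R) : basic (slice_normal w U) (slice_offset c h) v ->
  exists2 js, flag js v & forall i k : 'I_m, (i <= k)%N -> al (js k) <= al (js i).
Proof.
move=> bv; pose r i k := al k <= al i; pose l := sort r (enum (active v)).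
have sl : size l == m by rewrite size_sort -cardE card_active.
exists (tnth (Tuple sl)); last first.
  move=> i k ik; have [j0 _] : exists j : J, True by exists (tnth (Tuple sl) i).
  rewrite !(tnth_nth j0) /=.
  have tr : transitive r by move=> a b d ab bd; exact: le_trans bd ab.
  apply: (sorted_leq_nth tr) => //; rewrite ?inE ?(eqP sl)//.
  - by move=> a; exact: lexx.
  - by apply: sort_sorted => a b; exact: le_total.
split=> //.
  by apply/tuple_uniqP; rewrite /= sort_uniq enum_uniq.
apply/setP => j; apply/idP/imsetP.
  move=> jv; have : j \in Tuple sl by rewrite /= mem_sort mem_enum.
  by move=> /tnthP[i ->]; exists i.
move=> [i _ ->]; have := mem_tnth i (Tuple sl); by rewrite /= mem_sort mem_enum.
Qed.

Lemma flag_mem js v i : flag js v -> js i \in active v.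
Proof. by move=> [_ _ ->]; apply/imsetP; exists i. Qed.

Lemma flag_setP js (k : 'I_m) j :
  reflect (exists2 i : 'I_m, (i <= k)%N & j = js i) (j \in flag_set js k).
Proof. by apply: (iffP imsetP) => -[i]; rewrite ?inE => ik ->; exists i; rewrite ?inE. Qed.

Lemma flag_set_active js v k : flag js v -> flag_set js k \subset active v.
Proof. by move=> fl; apply/fintype.subsetP => j /flag_setP[i _ ->]; exact: (flag_mem _ fl). Qed.

Lemma mem_flag_set js (i k : 'I_m) : injective js -> (js i \in flag_set js k) = (i <= k)%N.
Proof.
move=> ji; apply/flag_setP/idP => [[l lk /ji ->//]|ik]; by exists i.
Qed.

Lemma flag_set_sub js (i k : 'I_m) : injective js ->
  (flag_set js i \subset flag_set js k) = (i <= k)%N.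
Proof.
move=> ji; apply/fintype.subsetP/idP => [/(_ (js i))|ik j /flag_setP[l li ->]].
  by rewrite !mem_flag_set// leqnn; exact.
by rewrite mem_flag_set//; exact: leq_trans li ik.
Qed.

Lemma dot_flag_set js (k : 'I_m) x : injective js ->
  dot (normal_sum (flag_set js k)) x = \sum_(i < m | (i <= k)%N) dot (U (js i)) x.
Proof.
move=> ji; rewrite dot_suml /flag_set big_imset/=; last by move=> ? ? _ _; exact: ji.
by apply: eq_bigl => i; rewrite inE.
Qed.

Lemma flag_set_triangular js (i : 'I_m) d : injective js ->
  (forall k : 'I_m, (k < i)%N -> dot (U (js k)) d = 0) ->
  dot (normal_sum (flag_set js i)) d = dot (U (js i)) d.
Proof.
move=> ji d0; rewrite dot_flag_set// (bigD1 i)//= big1 ?addr0// => k /andP[ki kni].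
by apply: d0; rewrite ltn_neqAle kni.
Qed.

Lemma flag_set_zero js (i : 'I_m) d : injective js ->
  (forall k : 'I_m, (k <= i)%N -> dot (normal_sum (flag_set js k)) d = 0) ->
  dot (U (js i)) d = 0.
Proof.
move=> ji; move: {2}(val i).+1 (ltnSn i) => N; elim: N i => // N IH i.
rewrite ltnS => iN d0; rewrite -flag_set_triangular ?d0// => k ki.
apply: IH; first exact: leq_trans ki iN.
by move=> l lk; apply: d0; exact: leq_trans lk (ltnW ki).
Qed.

Lemma flag_span js v d : flag js v -> dot w d = 0 ->
  (forall i, dot (U (js i)) d = 0) -> d = 0.
Proof.
move=> [bv _ av] wd jd; apply: (basic_slice bv wd) => j jv.
have : j \in active v by apply/activeP.
by rewrite av => /imsetP[i _ ->].
Qed.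

(** [d k] is the direction of the edge at the simple vertex [v] that leaves the facet [js k] and
    stays in the others. *)
Lemma vertex_dual js v : flag js v -> exists d : 'I_m -> V,
  [/\ forall k, dot w (d k) = 0,
      forall i k, dot (U (js i)) (d k) = (i == k)%:R
    & forall u, exists l, u = \sum_k dot u (d k) *: U (js k) + l *: w].
Proof.
by move=> fl; apply: (dual_basis (w := w)) => d wd jd; exact: (flag_span fl).
Qed.

(** [dot u (e k)] is the coordinate of [u] along the [k]-th face normal of the flag; the cone of the
    flag is where all these are nonnegative. *)
Lemma flag_dual js v : flag js v -> exists e : 'I_m -> V,
  [/\ forall k, dot w (e k) = 0,
      forall i k, dot (normal_sum (flag_set js i)) (e k) = (i == k)%:R
    & forall u, exists l, u = \sum_k dot u (e k) *: normal_sum (flag_set js k) + l *: w].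
Proof.
move=> fl; apply: (dual_basis (w := w)) => d wd jd; apply: (flag_span fl) => // i.
by case: fl => _ ji _; apply: flag_set_zero.
Qed.

(** At a simple vertex the facets can be left independently: [D] is the sum of the edge directions
    that leave the facets outside [s]. *)
Lemma is_simplex_sub s t : is_simplex t -> s \subset t -> is_simplex s.
Proof.
move=> [x Sx <-] sx; have [v bv xv] := simplex_vertex Sx.
have sv := fintype.subset_trans sx xv.
have [js fl _] := flag_exists (fun _ => 0) bv.
have [d [wd dd _]] := vertex_dual fl.
pose D := \sum_(k | js k \notin s) d k.
have jsD i : dot (U (js i)) D = (js i \notin s)%:R.
  rewrite dot_sumr big_mkcond (bigD1 i)//= dd eqxx big1 ?addr0.
    by case: ifP.
  by move=> k ki; case: ifP => // _; rewrite dd eq_sym (negbTE ki).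
have [Sv _] := bv; have wD : dot w D = 0 by rewrite dot_sumr big1.
have av j : j \in active v -> exists i, j = js i.
  by case: fl => _ _ -> /imsetP[i _ ->]; exists i.
have [|e e0 eS] := slice_small_step Sv wD.
  by move=> j /activeP/av[i ->]; rewrite jsD ler0n.
have Se : S (v + e *: D) by apply: eS; rewrite lexx ltW.
(* A facet inactive at [v] may become active at the end of the admissible step, but not halfway. *)
have Sh : S (v + (e / 2) *: D) by apply: eS; lra.
exists (v + (e / 2) *: D) => //; apply/setP => j.
have [jv|jv] := boolP (j \in active v).
  rewrite inE dotDr dotZr (activeP _ _ jv); have [i ji] := av _ jv.
  rewrite ji jsD; have [jsi|jsi] := boolP (js i \in s); first by rewrite mulr0 addr0 eqxx.
  by apply/negbTE; rewrite mulr1; apply/eqP; lra.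
transitivity false; last by apply/esym/negbTE; apply: contra jv => /(fintype.subsetP sv).
apply/negbTE; rewrite inE; move: jv; rewrite inE => jv.
have : h j < dot (U j) v by rewrite lt_neqAle eq_sym jv; have /in_slice[_ ->] := Sv.
have /in_slice[_ /(_ j)] := Se; rewrite !dot_simp => h1 h2.
by rewrite gt_eqF//; lra.
Qed.

Lemma flag_set_simplex js v k : flag js v -> is_simplex (flag_set js k).
Proof.
move=> fl; apply: (@is_simplex_sub _ (active v)); last exact: flag_set_active.
by exists v => //; case: fl => -[].
Qed.

(** Sorting the facets at a vertex by membership in [s] puts those of [s] first; [k] is the position
    of the last of them. *)
Lemma simplex_flag s : is_simplex s -> s != finset.set0 ->
  exists js v k, flag js v /\ flag_set js k = s.
Proof.
move=> [x Sx xs] s0; have [v bv] := simplex_vertex Sx; rewrite xs => xv.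
have [js fl jsm] := flag_exists (fun j => (j \in s)%:R) bv.
have [_ ji av] := fl.
have [j jx] := finset.set0Pn _ s0.
have : j \in active v := fintype.subsetP xv _ jx; rewrite av => /imsetP[i0 _ ji0].
have i0s : js i0 \in s by rewrite -ji0.
have [k ks kmax] := @arg_maxnP _ i0 (fun i => js i \in s) val i0s.
exists js, v, k; split=> //; apply/setP => l; apply/flag_setP/idP.
  move=> [i ik ->]; have := jsm _ _ ik; rewrite ks.
  by case: (js i \in s) => //; rewrite ler10.
move=> ls; have : l \in active v := fintype.subsetP xv _ ls.
by rewrite av => /imsetP[i _ li]; exists i => //; apply: kmax; rewrite -li.
Qed.

End SimpleSlice.

(** * Truncations *)

Section Cuts.
Variables (R : realType) (m : nat) (J : finType).
Local Notation V := 'rV[R]_(m.+1).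
Variables (U : J -> V) (h : J -> R) (w : V) (c : R).
Implicit Types (s t : {set J}) (x y v d u : V) (j : J) (js : 'I_m -> J).
Implicit Types (I : {set {set J}}) (e : {set J} -> R).

Local Notation S := (polyhedron (slice_normal w U) (slice_offset c h)).
Local Notation active := (active U h).
Local Notation slack := (slack U h).
Local Notation flag := (flag U h w c).
Local Notation is_simplex := (is_simplex U h w c).

Hypothesis nr : no_recession (slice_normal w U).
Hypothesis card_active :
  forall v, basic (slice_normal w U) (slice_offset c h) v -> #|active v| = m.

Definition cut I e : set V := [set x | S x /\ forall s, s \in I -> e s <= slack s x].

(** An index outside [I] carries a void constraint, so the index type stays fixed while [I]
    grows. *)
Definition cut_normal I (k : J + {set J}) : V :=
  match k with inl j => U j | inr s => if s \in I then normal_sum U s else 0 end.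

Definition cut_offset I e (k : J + {set J}) : R :=
  match k with inl j => h j
  | inr s => if s \in I then \sum_(j in s) h j + e s else 0 end.

Definition simplex_face s : set V := [set x | S x /\ s \subset active x].

Lemma cutE I e :
  cut I e = polyhedron (slice_normal w (cut_normal I)) (slice_offset c (cut_offset I e)).
Proof.
rewrite polyhedron_slice; apply/seteqP; split=> x.
  move=> [/in_slice[wx xh] xe]; split=> // -[j|s] /=; first exact: xh.
  by case: ifP => [/xe|]; rewrite ?dot0l// slackE; lra.
move=> [wx xk]; split; first by apply/in_slice; split=> // j; exact: (xk (inl j)).
by move=> s sI; have := xk (inr s); rewrite /= sI slackE; lra.
Qed.

Lemma cut_no_recession I : no_recession (slice_normal w (cut_normal I)).
Proof.
by move=> d /nr[[s|j] dj]; [exists (inl s)|exists (inr (inl j))].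
Qed.

Lemma cut_sub I e : cut I e `<=` S.
Proof. by move=> x []. Qed.

Lemma cut_tight_set I e x s : s \in I ->
  (inr (inr s) \in tight (slice_normal w (cut_normal I)) (slice_offset c (cut_offset I e)) x)
  = (slack s x == e s).
Proof.
move=> sI; rewrite inE /= sI slackE; apply/eqP/eqP; lra.
Qed.

Lemma cut_basic I e x : cut I e x ->
  (forall d, dot w d = 0 ->
     (forall j, j \in active x -> dot (U j) d = 0) ->
     (forall s, s \in I -> slack s x = e s -> dot (normal_sum U s) d = 0) -> d = 0) ->
  basic (slice_normal w (cut_normal I)) (slice_offset c (cut_offset I e)) x.
Proof.
move=> xI sp; apply: slice_basic; first by rewrite -cutE.
move=> d wd xd; apply: sp => // [j /activeP jx|s sI sx]; first exact: (xd (inl j)).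
by have := xd (inr s); rewrite /= sI; apply; move: sx; rewrite slackE; lra.
Qed.

(* [I] is the set of the faces cut off so far. A face of the flag outside [I] is
   still bounded by its slack being nonnegative. *)
Definition cut_vertices I e := forall js v, flag js v -> exists x,
  [/\ cut I e x,
      forall k, slack (flag_set js k) x
                = if flag_set js k \in I then e (flag_set js k) else 0,
      forall s, s \in I -> slack s x = e s -> exists k, s = flag_set js k
    & forall j, j \in active x ->
        exists2 k, j \in flag_set js k & flag_set js k \notin I].

Lemma cut_vertices0 e : cut_vertices finset.set0 e.
Proof.
move=> js v fl; have [[Sv _] ji av] := fl; exists v; split=> //.
- by split=> // s; rewrite finset.in_set0.
- by move=> k; rewrite finset.in_set0; apply/slack_eq0 => //; exact: flag_set_active fl.
- by move=> s; rewrite finset.in_set0.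
- move=> j; rewrite av => /imsetP[i _ ->]; exists i; last by rewrite finset.in_set0.
  by rewrite mem_flag_set.
Qed.

(** On [S] the slack is nonnegative and vanishes exactly on the face. As long as a part of the face
    survives, truncations at it are thus measured from the same level as on [S]. *)
Lemma face_in_cut I e s : (simplex_face s `&` cut I e) !=set0 ->
  simplex_face s `&` cut I e = face_in (cut I e) (normal_sum U s)
  /\ supp (cut I e) (normal_sum U s) = \sum_(j in s) h j.
Proof.
move=> [z [[Sz sz] zI]].
have uz : dot (normal_sum U s) z = \sum_(j in s) h j.
  by apply/eqP; rewrite -subr_eq0 -slackE; apply/eqP/slack_eq0.
have sE : supp (cut I e) (normal_sum U s) = \sum_(j in s) h j.
  rewrite (supp_min zI)// => y yI; rewrite uz -subr_ge0 -slackE.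
  by apply: slack_ge0; exact: cut_sub yI.
split=> //; apply/seteqP; rewrite /face_in sE; split=> x /=.
  move=> [[Sx sx] xI]; split=> //; apply/eqP; rewrite -subr_eq0 -slackE.
  by apply/eqP/slack_eq0.
move=> [xI ux]; split=> //; split; first exact: cut_sub xI.
by apply/slack_eq0; [exact: cut_sub xI|rewrite slackE ux subrr].
Qed.

Section Step.
Variables (I : {set {set J}}) (e : {set J} -> R) (s0 : {set J}).
(** Facet sets reverse the inclusion of faces: cutting smaller faces first means that [I] is closed
    upwards among simplices and contains everything above [s0]. *)
Hypothesis I_up : forall s t, s \in I -> s \subset t -> is_simplex t -> t \in I.
Hypotheses (s0_simplex : is_simplex s0) (s0_neq0 : s0 != finset.set0) (s0I : s0 \notin I).
Hypothesis s0_max : forall t, is_simplex t -> s0 \proper t -> t \in I.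
Hypothesis I_vertices : cut_vertices I e.
Hypotheses (e0 : 0 < e s0)
  (e_shallow : e s0 < depth (cut I e) (simplex_face s0 `&` cut I e) (normal_sum U s0)).

Lemma shallow_face : simplex_face s0 `&` cut I e = face_in (cut I e) (normal_sum U s0)
  /\ supp (cut I e) (normal_sum U s0) = \sum_(j in s0) h j.
Proof. by apply: face_in_cut; apply: depth_gt0_meets; exact: lt_trans e0 e_shallow. Qed.

Lemma cut_truncation : cut (s0 |: I) e = truncation (cut I e) (normal_sum U s0) (e s0).
Proof.
have [_ sE] := shallow_face.
apply/seteqP; split=> x; rewrite /truncation /= sE.
  move=> [Sx xe]; split; first by split=> // s sI; apply: xe; rewrite finset.in_setU1 sI orbT.
  by have := xe s0; rewrite finset.in_setU1 eqxx slackE => /(_ isT); lra.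
move=> [[Sx xe] xs]; split=> // s; rewrite finset.in_setU1 => /orP[/eqP ->|]; last exact: xe.
by rewrite slackE; lra.
Qed.

Lemma vertex_slack_gt y :
  basic (slice_normal w (cut_normal I)) (slice_offset c (cut_offset I e)) y ->
  ~~ (s0 \subset active y) -> e s0 < slack s0 y.
Proof.
move=> yb ys; apply: lt_le_trans e_shallow _.
have [FE sE] := shallow_face; rewrite slackE -sE; rewrite cutE in FE *.
apply: (depth_le (@cut_no_recession I) FE); last by move=> [[_ sy] _]; rewrite sy in ys.
by apply/basic_vertex => //; exact: cut_no_recession.
Qed.

Lemma flag_notin_le js v r k : flag js v -> s0 = flag_set js r ->
  (flag_set js k \notin I) = (k <= r)%N.
Proof.
move=> fl s0E; have [_ ji _] := fl; rewrite leqNgt; congr (~~ _); apply/idP/idP.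
  move=> kI; rewrite ltnNge; apply/negP => kr; move/negP: s0I; apply.
  by apply: (I_up kI) => //; rewrite s0E flag_set_sub.
move=> rk; apply: s0_max; first exact: (flag_set_simplex nr card_active _ fl).
by rewrite s0E properE !flag_set_sub// -ltnNge rk (ltnW rk).
Qed.

(** The point [x] is a vertex, being determined by the bounds of its flag. If it were on the face of
    [s0], the largest uncut set of the flag would contain [s0], properly since [s0] is not in the
    flag, so it would have been cut already. *)
Lemma cut_vertices_off js v x : flag js v -> (forall k, s0 != flag_set js k) ->
  [/\ cut I e x,
      forall k, slack (flag_set js k) x
                = if flag_set js k \in I then e (flag_set js k) else 0,
      forall s, s \in I -> slack s x = e s -> exists k, s = flag_set js k
    & forall j, j \in active x ->
        exists2 k, j \in flag_set js k & flag_set js k \notin I] ->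
  e s0 < slack s0 x.
Proof.
move=> fl s0js [xI xk xs xj]; have [_ ji _] := fl; have Sx := cut_sub xI.
apply: vertex_slack_gt.
  apply: (cut_basic xI) => d wd jd sd; apply: (flag_span fl) => // i.
  apply: (flag_set_zero ji) => k _; have [kI|kI] := boolP (flag_set js k \in I).
    by apply: sd => //; rewrite xk kI.
  have /(slack_eq0 _ Sx)/fintype.subsetP kx : slack (flag_set js k) x = 0.
    by rewrite xk (negbTE kI).
  by rewrite dot_suml big1// => j /kx/jd.
apply/negP => /fintype.subsetP s0x; have [j0 /s0x/xj[k0 _ k0I]] := finset.set0Pn _ s0_neq0.
have [k kI kmax] := @arg_maxnP _ k0 (fun k => flag_set js k \notin I) val k0I.
have s0k : s0 \subset flag_set js k.
  apply/fintype.subsetP => j /s0x/xj[l jl lI]; apply: fintype.subsetP jl.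
  by rewrite flag_set_sub//; exact: kmax.
move/negP: kI; apply; apply: s0_max; first exact: (flag_set_simplex nr card_active _ fl).
by rewrite finset.properEneq s0js.
Qed.

(** The dual direction [d] spans an edge from the old point [x0] to a vertex [y] off the face, and
    the new point [z] is strictly between them. So no constraint is tight at [z], apart from the new
    one, unless it was tight at [x0]. *)
Lemma cut_vertices_on js v r : flag js v -> s0 = flag_set js r -> exists x,
  [/\ cut (s0 |: I) e x,
      forall k, slack (flag_set js k) x
                = if flag_set js k \in s0 |: I then e (flag_set js k) else 0,
      forall s, s \in s0 |: I -> slack s x = e s -> exists k, s = flag_set js k
    & forall j, j \in active x ->
        exists2 k, j \in flag_set js k & flag_set js k \notin s0 |: I].
Proof.
move=> fl s0E; have [x0 [x0I x0k x0s x0j]] := I_vertices fl; have [_ ji av] := fl.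
have [dl [wdl dld _]] := flag_dual fl; pose d := dl r.
have Sx0 := cut_sub x0I.
have Ud (i : 'I_m) : (i <= r)%N -> dot (U (js i)) d = (i == r)%:R.
  move=> ir; rewrite -(@flag_set_triangular _ _ _ U js i d ji) ?dld// => k ki.
  apply: (flag_set_zero ji) => l lk; rewrite dld; case: eqP => // lr.
  by have := leq_ltn_trans lk (leq_trans ki ir); rewrite lr ltnn.
have kIr := flag_notin_le _ fl s0E.
have x0r : slack s0 x0 = 0.
  by rewrite s0E x0k -[_ \in I]negbK kIr leqnn.
pose N := slice_normal w (cut_normal I); pose O := slice_offset c (cut_offset I e).
have x0act j : j \in active x0 -> exists2 i : 'I_m, (i <= r)%N & j = js i.
  move=> /x0j[k /flag_setP[i ik ->]]; rewrite kIr => kr; exists i => //.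
  exact: leq_trans ik kr.
have x0d i : i \in tight N O x0 -> 0 <= dot (N i) d.
  case: i => [b _|[j|s]]; first by case: b; rewrite /= ?dotNl wdl ?oppr0.
    by move/tightP => /= /activeP/x0act[i ir ->]; rewrite Ud ?ler0n.
  rewrite inE /=; case: ifP => [sI|]; last by rewrite !dot0l.
  move=> sx; have [k ->] : exists k, s = flag_set js k.
    by apply: x0s => //; rewrite slackE (eqP sx); lra.
  by rewrite dld ler0n.
have bx0 : basic N O x0.
  apply: (cut_basic x0I) => d' wd jd sd; apply: (flag_span fl) => // i.
  apply: (flag_set_zero ji) => k _; have [kI|kI] := boolP (flag_set js k \in I).
    by apply: sd => //; rewrite x0k kI.
  have /(slack_eq0 _ Sx0)/fintype.subsetP kx : slack (flag_set js k) x0 = 0.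
    by rewrite x0k (negbTE kI).
  by rewrite dot_suml big1// => j /kx/jd.
have d0 : d != 0.
  by apply/eqP => d0; have := dld r r; rewrite -/d d0 dot0r eqxx => /eqP; rewrite eq_sym oner_eq0.
(* The facets [js i] with [i < r] and the bounds of the flag sets beyond [r] are tight at [x0] and
   orthogonal to [d]. Subtracting [k *: d] kills the flag set of [r] too, and with it the whole
   flag. *)
have span d' : (forall i, i \in tight N O x0 -> dot (N i) d = 0 -> dot (N i) d' = 0) ->
    exists k, d' = k *: d.
  move=> d'0; pose k := dot (normal_sum U s0) d'; exists k.
  apply/eqP; rewrite -subr_eq0; apply/eqP.
  have wd' : dot w d' = 0.
    apply: (d'0 (inl true)); last exact: wdl.
    by apply: slice_tightW; have /in_slice[] := Sx0.
  apply: (flag_span fl); first by rewrite dotBr dotZr wd' wdl mulr0 subr0.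
  have U0 (i : 'I_m) : (i < r)%N -> dot (U (js i)) (d' - k *: d) = 0.
    move=> ir; rewrite dotBr dotZr Ud ?(ltnW ir)// (_ : (i == r) = false) ?mulr0 ?subr0; last first.
      by apply/negbTE; apply: contraTneq ir => ->; rewrite ltnn.
    apply: (d'0 (inr (inl (js i)))); last first.
      rewrite /= Ud ?(ltnW ir)//; apply/eqP; rewrite pnatr_eq0 eqb0.
      by apply: contraTneq ir => ->; rewrite ltnn.
    have /(slack_eq0 _ Sx0)/fintype.subsetP sx := x0r; rewrite inE /=.
    apply/eqP/activeP/sx.
    by rewrite s0E mem_flag_set// ltnW.
  move=> i; apply: (flag_set_zero ji) => l _; have [lr|rl|lr] := ltngtP l r.
  - rewrite (flag_set_triangular ji) ?U0// => l' l'l; apply: U0; exact: ltn_trans l'l lr.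
  - have lI : flag_set js l \in I by rewrite -[_ \in I]negbK kIr -ltnNge.
    rewrite dotBr dotZr dld (_ : (l == r) = false) ?mulr0 ?subr0; last first.
      by apply/negbTE; apply: contraTneq rl => ->; rewrite ltnn.
    have := d'0 (inr (inr (flag_set js l))); rewrite /N /= lI; apply.
      by rewrite cut_tight_set// x0k lI.
    by rewrite dld; apply/eqP; rewrite pnatr_eq0 eqb0; apply: contraTneq rl => ->; rewrite ltnn.
  - have -> : l = r by exact: val_inj.
    by rewrite dotBr dotZr dld eqxx mulr1 -s0E subrr.
have [t [t0 yb _]] := edge_ray (@cut_no_recession I) bx0 d0 x0d span.
set y := x0 + t *: d in yb.
have yI : cut I e y by rewrite cutE; case: yb.
have sy : slack s0 y = t.
  by rewrite slackD x0r add0r s0E dld eqxx mulr1.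
have et : e s0 < t.
  rewrite -sy; apply: vertex_slack_gt => //; apply/negP => s0y.
  by have /(slack_eq0 _ (cut_sub yI)) := s0y; rewrite sy => t0'; rewrite t0' ltxx in t0.
pose z := x0 + e s0 *: d; pose q := e s0 / t.
have q0 : 0 < q by rewrite divr_gt0.
have q1 : q < 1 by rewrite ltr_pdivrMr// mul1r.
have qt : q * t = e s0 by rewrite divfK// gt_eqF.
have zs s : slack s z = (1 - q) * slack s x0 + q * slack s y.
  by rewrite !slackD -qt; ring.
have zj j : dot (U j) z = (1 - q) * dot (U j) x0 + q * dot (U j) y.
  by rewrite !dot_simp -qt; ring.
have Sz : S z.
  have /in_slice[wx0 hx0] := Sx0; have /in_slice[_ hy] := cut_sub yI.
  apply/in_slice; split; first by rewrite !dot_simp wx0 wdl mulr0 addr0.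
  by move=> j; rewrite zj; have := hx0 j; have := hy j; nra.
have zs0 : slack s0 z = e s0 by rewrite zs x0r sy mulr0 add0r.
have zk k : slack (flag_set js k) z = slack (flag_set js k) x0 + e s0 * (k == r)%:R.
  by rewrite slackD dld.
have kr k : (flag_set js k == s0) = (k == r).
  apply/eqP/eqP => [|->//]; rewrite s0E => kr; apply/val_inj/anti_leq.
  by rewrite -!(flag_set_sub _ _ ji) kr fintype.subxx.
exists z; split.
- split=> // s; rewrite finset.in_setU1 => /orP[/eqP ->|sI]; first by rewrite zs0.
  rewrite zs; have [_ /(_ s sI) ey] := yI; have [_ /(_ s sI) ex] := x0I; nra.
- move=> k; rewrite zk finset.in_setU1 kr x0k; have [->|_] := eqVneq k r.
    by rewrite -[_ \in I]negbK kIr leqnn/= -s0E mulr1 add0r.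
  by rewrite mulr0 addr0.
- move=> s; rewrite finset.in_setU1 => /orP[/eqP -> _|sI]; first by exists r.
  rewrite zs => sz; apply: x0s => //.
  have [_ /(_ s sI) ey] := yI; have [_ /(_ s sI) ex] := x0I; nra.
- move=> j /activeP jz.
  have jx0 : j \in active x0.
    apply/activeP; move: jz; rewrite zj; have /in_slice[_ /(_ j) hx0] := Sx0.
    have /in_slice[_ /(_ j) hy] := cut_sub yI; nra.
  have [i ir ji'] := x0act _ jx0.
  (* The facet [js r] is left: its slack grows from zero to [e s0]. *)
  have ir' : (i < r)%N.
    rewrite ltn_neqAle ir andbT; apply/negP => /eqP/val_inj ei.
    move: jz; rewrite ji' !dot_simp Ud// ei eqxx -ei -ji' (activeP _ _ _ _ jx0) mulr1.
    by move: e0; lra.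
  exists i; first by rewrite ji' mem_flag_set.
  rewrite finset.in_setU1 kr negb_or kIr ir andbT.
  by apply: contraTneq ir' => ->; rewrite ltnn.
Qed.

Lemma cut_vertices_step : cut_vertices (s0 |: I) e.
Proof.
move=> js v fl; have [[r s0E]|nr0] := pselect (exists r, s0 = flag_set js r).
  exact: (cut_vertices_on fl s0E).
have s0js k : s0 != flag_set js k by apply/eqP => s0E; apply: nr0; exists k.
have [x hx] := I_vertices fl; have ex := cut_vertices_off fl s0js hx.
have [[Sx xI] xk xs xj] := hx.
have notin k : (flag_set js k \in s0 |: I) = (flag_set js k \in I).
  by rewrite finset.in_setU1 eq_sym (negbTE (s0js k)).
exists x; split.
- split=> // s; rewrite finset.in_setU1 => /orP[/eqP ->|]; [exact: ltW|exact: xI].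
- by move=> k; rewrite notin.
- move=> s; rewrite finset.in_setU1 => /orP[/eqP -> e1|sI]; last exact: xs.
  by rewrite e1 ltxx in ex.
- by move=> j /xj[k jk kI]; exists k; rewrite ?notin.
Qed.

End Step.

End Cuts.

(** * Normal fans *)

Section Fans.
Variables (R : realType) (m : nat) (J : finType).
Local Notation V := 'rV[R]_(m.+1).
Variables (U : J -> V) (h : J -> R) (w : V) (c : R).
Implicit Types (s t : {set J}) (x y v d u : V) (j : J) (js : 'I_m -> J).

Local Notation S := (polyhedron (slice_normal w U) (slice_offset c h)).
Local Notation active := (active U h).
Local Notation slack := (slack U h).
Local Notation flag := (flag U h w c).
Local Notation is_simplex := (is_simplex U h w c).
Local Notation cut := (cut U h w c).
Local Notation normal_sum := (normal_sum U).

Hypothesis nr : no_recession (slice_normal w U).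
Hypothesis card_active :
  forall v, basic (slice_normal w U) (slice_offset c h) v -> #|active v| = m.

Lemma vertex_dual_sum js v (d : 'I_m -> V) s k : flag js v ->
  (forall i k, dot (U (js i)) (d k) = (i == k)%:R) -> s \subset active v ->
  dot (normal_sum s) (d k) = (js k \in s)%:R.
Proof.
move=> [_ ji av] dd /fintype.subsetP sv; rewrite dot_suml.
rewrite (eq_bigr (fun j => (j == js k)%:R)); last first.
  by move=> j /sv; rewrite av => /imsetP[i _ ->]; rewrite dd (inj_eq ji).
have [ks|ks] := boolP (js k \in s).
  by rewrite (bigD1 (js k))//= eqxx big1 ?addr0// => j /andP[_ /negbTE ->].
by rewrite big1// => j jS; case: eqP => // jk; rewrite -jk jS in ks.
Qed.

Hypothesis S_neq0 : S !=set0.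

Definition flag_frame js v (e : 'I_m -> V) := [/\ flag js v,
  forall k, dot w (e k) = 0,
  forall i k, dot (normal_sum (flag_set js i)) (e k) = (i == k)%:R
  & forall u, exists l, u = \sum_k dot u (e k) *: normal_sum (flag_set js k) + l *: w].

Lemma flag_framed js v : flag js v -> exists e, flag_frame js v e.
Proof. by move=> fl; have [e [we ee eu]] := flag_dual fl; exists e. Qed.

Lemma frame_sum js v e (u : V) : flag_frame js v e -> exists l, forall x,
  dot u x = \sum_k dot u (e k) * dot (normal_sum (flag_set js k)) x + l * dot w x.
Proof.
move=> [_ _ _ /(_ u)[l ul]]; exists l => x; rewrite [in LHS]ul dotDl dotZl dot_suml.
by congr (_ + _); apply: eq_bigr => k _; rewrite dotZl.
Qed.

(* Abel summation: the coordinates of [u] along the flag are the successive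
   differences of its coordinates along the facet normals at [v], so sorting the
   latter makes the former nonnegative. *)
Lemma flag_cone u : exists js v e, flag_frame js v e /\ forall k, 0 <= dot u (e k).
Proof.
have [v [bv vmin]] := supp_attained u nr S_neq0; have [Sv _] := bv.
have [js0 fl0 _] := flag_exists card_active (fun _ => 0) bv.
have [d0 [wd0 dd0 du0]] := vertex_dual fl0; have [_ ji0 av0] := fl0.
(* The coordinates of [u] at [v] as a function on facets, independent of the order [js0], so that
   [flag_exists] can sort by it. *)
pose al j := \sum_k (js0 k == j)%:R * dot u (d0 k).
have [l0 ul0] := du0 u.
have uE : u = \sum_(j in active v) al j *: U j + l0 *: w.
  rewrite {1}ul0 av0 big_imset/=; last by move=> ? ? _ _; exact: ji0.
  congr (_ + _); apply: eq_big => // k _; congr (_ *: _).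
  rewrite /al (bigD1 k)//= eqxx mul1r big1 ?addr0// => i ik.
  by rewrite (inj_eq ji0) (negbTE ik) mul0r.
have [js fl als] := flag_exists card_active al bv; have [_ ji av] := fl.
have [d [wd dd _]] := vertex_dual fl; have [e fr] := flag_framed fl.
exists js, v, e; split=> // k.
have ud i : dot u (d i) = al (js i).
  rewrite uE dotDl dotZl wd mulr0 addr0 dot_suml av big_imset/=; last by move=> ? ? _ _; exact: ji.
  rewrite (bigD1 i)//= dotZl dd eqxx mulr1 big1 ?addr0// => l li.
  by rewrite dotZl dd (negbTE li) mulr0.
have ud0 i : 0 <= dot u (d i).
  have [|t t0 /(_ t)] := slice_small_step Sv (wd i).
    move=> j jv; have : j \in active v by apply/activeP.
    by rewrite av => /imsetP[l _ ->]; rewrite dd ler0n.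
  rewrite lexx ltW// => /(_ isT) /vmin; rewrite dotDr dotZr lerDl.
  by rewrite pmulr_rge0.
(* [e k] is the difference of two successive edge directions; after the last position the next one
   is [0]. *)
pose nxt := oapp d 0 (insub k.+1).
have wnxt : dot w nxt = 0 by rewrite /nxt; case: insub => [l|]; rewrite /= ?wd ?dot0r.
have sgd i l : dot (normal_sum (flag_set js i)) (d l) = (l <= i)%N%:R.
  by rewrite (vertex_dual_sum _ fl dd) ?mem_flag_set//; exact: flag_set_active fl.
have sgn (i : 'I_m) : dot (normal_sum (flag_set js i)) nxt = (k < i)%N%:R.
  rewrite /nxt; case: insubP => [l _ lk|]; rewrite /= ?sgd ?lk// -leqNgt => mk.
  by rewrite dot0r ltnNge -ltnS (leq_trans (ltn_ord i) mk).
have ek : dot u (e k) = dot u (d k - nxt).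
  have [l uL] := frame_sum u fr; rewrite [RHS]uL [dot w _]dotBr wd wnxt subrr mulr0 addr0.
  rewrite (bigD1 k)//= big1 ?addr0; last first.
    move=> i ik; rewrite dotBr sgd sgn [(k <= i)%N]leq_eqVlt val_eqE eq_sym.
    by rewrite (negbTE ik)/= subrr mulr0.
  by rewrite dotBr sgd sgn leqnn ltnn subr0 mulr1.
rewrite ek dotBr subr_ge0 /nxt; case: insubP => [l _ lk|_]; rewrite /= ?dot0r//.
by rewrite !ud; apply: als; rewrite lk.
Qed.

(** On [S], [u] is a constant plus the combination of the flag slacks with the nonnegative
    coefficients [dot u (e k)]. *)
Lemma cone_min js v e u (Q : set V) x : flag_frame js v e ->
  (forall k, 0 <= dot u (e k)) -> Q `<=` S -> Q x ->
  (forall y k, Q y -> slack (flag_set js k) x <= slack (flag_set js k) y) ->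
  forall y, Q y -> dot u x <= dot u y.
Proof.
move=> fr u0 QS Qx xmin y Qy; have [l uE] := frame_sum u fr; rewrite !uE.
have [/in_slice[-> _] /in_slice[-> _]] := (QS _ Qx, QS _ Qy).
rewrite lerD2r; apply: ler_sum => k _; apply: ler_wpM2l => //.
by have := xmin y k Qy; rewrite !slackE lerD2r.
Qed.

(** Complementary slackness for the combination in [cone_min]. *)
Lemma cone_min_eq js v e u (Q : set V) x y : flag_frame js v e ->
  (forall k, 0 <= dot u (e k)) -> Q `<=` S -> Q x -> Q y ->
  (forall z k, Q z -> slack (flag_set js k) x <= slack (flag_set js k) z) ->
  dot u y = dot u x ->
  forall k, dot u (e k) != 0 -> slack (flag_set js k) y = slack (flag_set js k) x.
Proof.
move=> fr u0 QS Qx Qy xmin; have [l uE] := frame_sum u fr; rewrite !uE.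
have [/in_slice[-> _] /in_slice[-> _]] := (QS _ Qx, QS _ Qy).
move=> /addIr/eqP; rewrite -subr_eq0 -sumrB => /eqP/psumr_eq0P s0 k uk.
have {}s0 := s0 _ k isT; apply/eqP; rewrite -subr_eq0.
have : dot u (e k) * (slack (flag_set js k) y - slack (flag_set js k) x) = 0.
  rewrite !slackE -[RHS]s0 => [|i _]; first by ring.
  rewrite -mulrBr mulr_ge0// subr_ge0; have := xmin y i Qy; rewrite !slackE; lra.
by move/eqP; rewrite mulf_eq0 (negbTE uk).
Qed.

Section NormalFan.
Variables (I : {set {set J}}) (ep : {set J} -> R).
Hypothesis I_simplex : forall s, s \in I <-> is_simplex s /\ s != finset.set0.
Hypothesis I_vertices : cut_vertices U h w c I ep.

Local Notation P := (cut I ep).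

Lemma flag_set_neq0 js (k : 'I_m) : flag_set js k != finset.set0.
Proof. by apply/finset.set0Pn; exists (js k); apply/flag_setP; exists k. Qed.

Lemma flag_set_cut js v k : flag js v -> flag_set js k \in I.
Proof.
move=> fl; apply/I_simplex; split; last exact: flag_set_neq0.
exact: (flag_set_simplex nr card_active _ fl).
Qed.

Lemma flag_point js v : flag js v -> exists x, [/\ P x,
  forall k, slack (flag_set js k) x = ep (flag_set js k),
  forall s, s \in I -> slack s x = ep s -> exists k, s = flag_set js k
  & forall j, j \notin active x].
Proof.
move=> fl; have [x [Px xk xs xj]] := I_vertices fl; exists x; split=> //.
  by move=> k; rewrite xk (flag_set_cut _ fl).
by move=> j; apply/negP => /xj[k _]; rewrite (flag_set_cut _ fl).
Qed.

Lemma flag_point_min js v x : flag js v ->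
  (forall k, slack (flag_set js k) x = ep (flag_set js k)) ->
  forall y k, P y -> slack (flag_set js k) x <= slack (flag_set js k) y.
Proof. by move=> fl xk y k [_ yI]; rewrite xk; apply: yI; exact: flag_set_cut fl. Qed.

Lemma supp_le_cut u x : P x -> supp P u <= dot u x.
Proof. by rewrite cutE; exact: supp_le (@cut_no_recession _ _ _ _ _ nr I). Qed.

(** Only bounds of the flag are tight at its point [x], so [x] can move along [e k] inside [P], and
    even inside the face of [u] if [u] vanishes on [e k]. Hence the normal cone is contained in the
    face of the flag cone that has [u] in its relative interior. *)
Lemma normal_cone_frame js v e u u' : flag_frame js v e -> (forall k, 0 <= dot u (e k)) ->
  normal_cone P (face_in P u) u' ->
  forall k, 0 <= dot u' (e k) /\ (dot u (e k) = 0 -> dot u' (e k) = 0).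
Proof.
move=> fr u0 nu' k; have [fl we ee _] := fr.
have [x [Px xk xs xj]] := flag_point fl.
have xmin := cone_min fr u0 (@cut_sub _ _ _ U h w c I ep) Px (flag_point_min fl xk).
have xu : face_in P u x by exact: face_in_min.
have [|||t t0 /(_ t)] := @slice_small_step _ _ _ w c (cut_normal U I) (cut_offset h I ep) x (e k).
- by rewrite -cutE.
- exact: we.
- case=> [j jx|s]; first by have /negP[] := xj j; rewrite inE; exact/eqP.
  rewrite /=; case: ifP => [sI sx|_ _]; last by rewrite dot0l.
  have [|l ->] := xs s sI; last by rewrite ee ler0n.
  by rewrite slackE sx; ring.
rewrite lexx ltW// -cutE => /(_ isT) Pt; have ux := nu' _ xu; split.
  by have := supp_le_cut u' Pt; rewrite -ux dotDr dotZr lerDl pmulr_rge0.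
move=> uk; have : face_in P u (x + t *: e k).
  by split=> //; have [_ <-] := xu; rewrite dotDr dotZr uk mulr0 addr0.
move=> /nu'; rewrite -ux dotDr dotZr => /eqP; rewrite -subr_eq0 addrC addKr.
by rewrite mulf_eq0 (gt_eqF t0) => /eqP.
Qed.

Lemma normal_fanP C : normal_fan P C <-> exists u, C = normal_cone P (face_in P u).
Proof.
split=> [[F [[->|[u ->]] F0 ->]]|[u ->]]; first by case: F0.
  by exists u.
exists (face_in P u); split=> //; first by right; exists u.
have [js [v [e [fr u0]]]] := flag_cone u; have [fl _ _ _] := fr.
have [x [Px xk _ _]] := flag_point fl; exists x; apply: face_in_min => //.
exact: (cone_min fr u0 (@cut_sub _ _ _ U h w c I ep) Px (flag_point_min fl xk)).
Qed.

Lemma flag_cone_in_fan js v e : flag_frame js v e ->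
  exists2 C, normal_fan P C & forall u, (forall k, 0 <= dot u (e k)) -> C u.
Proof.
move=> fr; have [fl we ee _] := fr; have [x [Px xk _ _]] := flag_point fl.
(* A functional interior to the flag cone: its minimum forces every slack of the flag to be
   minimal. *)
pose u := \sum_k normal_sum (flag_set js k).
exists (normal_cone P (face_in P u)); first by apply/normal_fanP; exists u.
move=> u' u'0 y [Py uy].
have u1 k : dot u (e k) = 1.
  rewrite dot_suml (bigD1 k)//= ee eqxx big1 ?addr0// => i ik.
  by rewrite ee (negbTE ik).
have xm := flag_point_min fl xk; have PS := @cut_sub _ _ _ U h w c I ep.
have umin u2 pos := @cone_min _ _ _ u2 _ _ fr pos PS Px xm.
have u0 k : 0 <= dot u (e k) by rewrite u1.
have yk k : slack (flag_set js k) y = slack (flag_set js k) x.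
  apply: (cone_min_eq fr u0 PS Px Py xm); last by rewrite u1 oner_neq0.
  by rewrite uy (supp_min Px)//; exact: umin.
rewrite (supp_min Px (umin _ u'0)); have [l uE] := frame_sum u' fr; rewrite !uE.
have [/in_slice[-> _] /in_slice[-> _]] := (PS _ Px, PS _ Py).
congr (_ + _); apply: eq_bigr => k _; congr (_ * _).
by have := yk k; rewrite !slackE => /addIr.
Qed.

Section Coarsening.
Variable (Q : set V).
Hypotheses (QS : Q `<=` S).
Hypothesis Q_flag : forall js v, flag js v ->
  exists2 x, Q x & forall y k, Q y -> slack (flag_set js k) x <= slack (flag_set js k) y.

Lemma supp_frame js v e x : flag_frame js v e -> Q x ->
  (forall y k, Q y -> slack (flag_set js k) x <= slack (flag_set js k) y) ->
  forall u, (forall k, 0 <= dot u (e k)) -> supp Q u = dot u x.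
Proof. by move=> fr Qx xm u u0; apply: supp_min => //; exact: cone_min fr u0 QS Qx xm. Qed.

(** A cone of [Q] is the union of the cones of [P] inside it: if [u] is minimal at [z], so is each
    [u'] in the cone of [P] around [u], because by [normal_cone_frame] the coordinates of [u'] are
    supported where those of [u] are. *)
Lemma fan_coarsens : coarsens (normal_fan Q) (normal_fan P).
Proof.
move=> C [E [fE [z0 Ez0] ->]].
exists [set C' | normal_fan P C' /\ C' `<=` normal_cone Q E]; first by move=> C' [].
apply/seteqP; split=> [u uE|u [C' [_ sub]]]; last exact: sub.
exists (normal_cone P (face_in P u)); last by move=> y [].
split; first by apply/normal_fanP; exists u.
have EQ : E `<=` Q by case: fE => [->//|[u1 ->] x []].
move=> u' nu' z Ez; have [js [v [e [fr u0]]]] := flag_cone u.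
have [fl _ _ _] := fr; have [x Qx xm] := Q_flag fl.
have u'e := normal_cone_frame fr u0 nu'.
have u'0 k : 0 <= dot u' (e k) by case: (u'e k).
rewrite (supp_frame fr Qx xm)//.
have zx := cone_min_eq fr u0 QS Qx (EQ _ Ez) xm.
have {}zx := zx (etrans (uE _ Ez) (supp_frame fr Qx xm u0)).
have [l lE] := frame_sum u' fr; rewrite !lE.
have [/in_slice[-> _] /in_slice[-> _]] := (QS Qx, QS (EQ _ Ez)).
congr (_ + _); apply: eq_bigr => k _.
have [uk|uk] := eqVneq (dot u (e k)) 0; first by have [_ ->] := u'e k; rewrite ?mul0r.
by congr (_ * _); have := zx k uk; rewrite !slackE => /addIr.
Qed.

End Coarsening.

End NormalFan.

End Fans.

(** * Deep truncations *)

Section DotLinear.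
Variables (R : realType) (n : nat) (x : 'rV[R]_n).

Definition dotr (u : 'rV[R]_n) : R := dot u x.

Fact dotr_is_linear : linear_for *%R dotr.
Proof. by move=> k u v; rewrite /dotr dotDl dotZl. Qed.

HB.instance Definition _ := GRing.isLinear.Build R 'rV[R]_n R *%R dotr dotr_is_linear.

End DotLinear.

(** Möbius inversion on the Boolean lattice, by recursion on the size of the sets. *)
Lemma subset_sum_solve (R : realType) (J : finType) (f : {set J} -> R) :
  exists a : {set J} -> R, forall s : {set J}, \sum_(t : {set J} | t \subset s) a t = f s.
Proof.
suff H k : exists a : {set J} -> R,
    forall s : {set J}, (#|s| < k)%N -> \sum_(t : {set J} | t \subset s) a t = f s.
  have [a ha] := H #|J|.+1; exists a => s; apply: ha; rewrite ltnS.
  exact: max_card.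
elim: k => [|k [a ha]]; first by exists f.
pose b (s : {set J}) := if (#|s| < k)%N then a s else f s - \sum_(t : {set J} | t \proper s) a t.
have bs (s : {set J}) : (#|s| <= k)%N ->
    \sum_(t : {set J} | t \proper s) b t = \sum_(t : {set J} | t \proper s) a t.
  by move=> sk; apply: eq_bigr => t /proper_card ts; rewrite /b (leq_trans ts sk).
have split_s (g : {set J} -> R) (s : {set J}) :
    \sum_(t : {set J} | t \subset s) g t = g s + \sum_(t : {set J} | t \proper s) g t.
  rewrite (bigD1 s)//=; congr (_ + _); apply: eq_bigl => t.
  by rewrite finset.properEneq andbC.
exists b => s; rewrite ltnS => sk; rewrite split_s bs// /b; case: ifP => sk'.
  by rewrite -split_s ha.
by rewrite subrK.
Qed.

Section DeepTruncations.
Variables (R : realType) (m : nat) (J : finType).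
Local Notation V := 'rV[R]_(m.+1).
Variables (U : J -> V) (h : J -> R) (w : V) (c : R).
Implicit Types (s t : {set J}) (x y v d u : V) (j : J) (js : 'I_m -> J).

Local Notation S := (polyhedron (slice_normal w U) (slice_offset c h)).
Local Notation active := (active U h).
Local Notation slack := (slack U h).
Local Notation flag := (flag U h w c).
Local Notation is_simplex := (is_simplex U h w c).
Local Notation cut := (cut U h w c).
Local Notation normal_sum := (normal_sum U).
Local Notation simplex_face := (simplex_face U h w c).
Local Notation flag_frame := (flag_frame U h w c).

Hypothesis nr : no_recession (slice_normal w U).
Hypothesis card_active :
  forall v, basic (slice_normal w U) (slice_offset c h) v -> #|active v| = m.
Hypothesis S_neq0 : S !=set0.

(* Here [set0] stands for the empty face, whose deep truncation is [S] by
   convention, and not for [S] as a face. *)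
Definition deep s : set V :=
  if s == finset.set0 then S
  else cut [set s]%SET (fun t => depth S (simplex_face t) (normal_sum t)).

(* The minimum over [deep s] of the slack of [t]. *)
Definition deep_value s t : R :=
  if (s != finset.set0) && (s \subset t) then depth S (simplex_face s) (normal_sum s)
  else 0.

Lemma simplex_set0 : is_simplex finset.set0.
Proof.
have [x Sx] := S_neq0; apply: (is_simplex_sub nr card_active _ (finset.sub0set (active x))).
by exists x.
Qed.

Lemma simplex_faceE s : is_simplex s -> simplex_face s = face_in S (normal_sum s)
  /\ supp S (normal_sum s) = \sum_(j in s) h j.
Proof.
move=> [x Sx xs].
have cut0 : cut finset.set0 (fun=> 0) = S.
  by apply/seteqP; split=> [y [] //|y Sy]; split=> // t; rewrite finset.in_set0.
have := @face_in_cut _ _ _ U h w c finset.set0 (fun=> 0) s; rewrite cut0.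
have -> : simplex_face s `&` S = simplex_face s by apply: setIidl => y [].
by apply; exists x; split=> //; rewrite xs.
Qed.

Lemma simplex_depth_gt0 s : is_simplex s -> s != finset.set0 ->
  0 < depth S (simplex_face s) (normal_sum s).
Proof.
move=> ss s0; have [x Sx x0] := simplex_set0.
apply: (depth_gt0 nr (proj1 (simplex_faceE ss)) Sx) => -[_].
by rewrite x0 finset.subset0 (negbTE s0).
Qed.

Lemma simplex_depth_le s v : is_simplex s ->
  basic (slice_normal w U) (slice_offset c h) v -> ~~ (s \subset active v) ->
  depth S (simplex_face s) (normal_sum s) <= slack s v.
Proof.
move=> ss bv sv; have [FE sE] := simplex_faceE ss; rewrite slackE -sE.
apply: (depth_le nr FE); first exact/basic_vertex.
by move=> [_ sv']; rewrite sv' in sv.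
Qed.

Lemma deep_sub s : deep s `<=` S.
Proof. by rewrite /deep; case: ifP => _ x // []. Qed.

Lemma deep_value_le s t x : deep s x -> deep_value s t <= slack t x.
Proof.
move=> dx; have Sx := deep_sub dx; rewrite /deep_value.
case: ifP => [/andP[s0 st]|_]; last exact: slack_ge0 Sx.
move: dx; rewrite /deep (negbTE s0) => -[_ /(_ s)]; rewrite finset.in_set1 eqxx => /(_ isT) h1.
by apply: le_trans h1 _; exact: slack_mono Sx st.
Qed.

(** If [s] is empty or [v] is off its face, [v] itself serves. Otherwise move from [v] along the
    edge leaving [js i], the last facet of [s] in the flag: this raises the slack of a flag set
    exactly if it contains [s]. The other end is a vertex off the face, so the edge reaches the
    depth. *)
Lemma deep_flag s js v : is_simplex s -> flag js v ->
  exists2 x, deep s x & forall k, slack (flag_set js k) x = deep_value s (flag_set js k).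
Proof.
move=> ss fl; have [bv ji av] := fl; have [Sv _] := bv.
have vk k : slack (flag_set js k) v = 0.
  by apply/(slack_eq0 _ Sv); exact: flag_set_active fl.
have [s0|s0] := eqVneq s finset.set0.
  by exists v => [|k]; rewrite /deep /deep_value s0 eqxx.
have [sv|sv] := boolP (s \subset active v); last first.
  exists v => [|k].
    rewrite /deep (negbTE s0); split=> // t; rewrite finset.in_set1 => /eqP ->.
    exact: simplex_depth_le.
  rewrite vk /deep_value s0/= ifN//; apply: contra sv => sk.
  exact: fintype.subset_trans sk (flag_set_active _ fl).
have [d [wd dd du]] := vertex_dual fl.
have sdk := vertex_dual_sum _ fl dd.
have [j0 j0s] := finset.set0Pn _ s0.
have : j0 \in active v := fintype.subsetP sv _ j0s; rewrite av => /imsetP[i0 _ ji0].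
have i0s : js i0 \in s by rewrite -ji0.
have [i is_s imax] := @arg_maxnP _ i0 (fun i => js i \in s) val i0s.
have sik k : (s \subset flag_set js k) = (i <= k)%N.
  apply/fintype.subsetP/idP => [/(_ _ is_s)|ik j jS]; first by rewrite mem_flag_set.
  have : j \in active v := fintype.subsetP sv _ jS; rewrite av => /imsetP[l _ jl].
  rewrite jl mem_flag_set//; apply: leq_trans ik; apply: imax; by rewrite -jl.
have d0 : d i != 0.
  by apply/eqP => d0; have /eqP := dd i i; rewrite d0 dot0r eqxx eq_sym oner_eq0.
have actv j : dot (U j) v = h j -> exists l, j = js l.
  move=> jv; have : j \in active v by apply/activeP.
  by rewrite av => /imsetP[l _ ->]; exists l.
have [||t [t0 by_ _]] := @edge_ray _ _ _ (slice_normal w U) (slice_offset c h) nr v (d i) bv d0.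
- case=> [b _|j]; first by case: b; rewrite /= ?dotNl wd ?oppr0.
  by rewrite slice_tight => /eqP/actv[l ->]; rewrite /= dd ler0n.
- move=> d' d'0; exists (dot (U (js i)) d').
  apply/eqP; rewrite -subr_eq0; apply/eqP; apply: (flag_span fl).
    rewrite dotBr dotZr wd mulr0 subr0; apply: (d'0 (inl true)); last exact: wd.
    by apply: slice_tightW; have /in_slice[] := Sv.
  move=> l; rewrite dotBr dotZr dd; have [->|li] := eqVneq l i; first by rewrite mulr1 subrr.
  rewrite mulr0 subr0; apply: (d'0 (inr (js l))); last by rewrite /= dd (negbTE li).
  by rewrite slice_tight; apply/eqP/activeP; exact: flag_mem fl.
pose de := depth S (simplex_face s) (normal_sum s).
have sv0 : slack s v = 0 by apply/(slack_eq0 _ Sv).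
have det : de <= t.
  have sy : slack s (v + t *: d i) = t by rewrite slackD sv0 sdk// is_s add0r mulr1.
  rewrite -sy; apply: simplex_depth_le => //; apply/negP => sy0; have [Sy _] := by_.
  by have := (slack_eq0 s Sy).2 sy0; rewrite sy => t00; rewrite t00 ltxx in t0.
have de0 : 0 < de by exact: simplex_depth_gt0.
have Sx : S (v + de *: d i).
  have [/in_slice[wy hy] _] := by_; have /in_slice[wv hv] := Sv.
  apply/in_slice; split; first by rewrite !dot_simp wv wd mulr0 addr0.
  move=> j; have := hy j; have := hv j; rewrite !dot_simp.
  have [dj|dj] := leP 0 (dot (U j) (d i)); nra.
exists (v + de *: d i).
  rewrite /deep (negbTE s0); split=> // t'; rewrite finset.in_set1 => /eqP ->.
  by rewrite slackD sv0 sdk// is_s add0r mulr1.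
move=> k; rewrite slackD vk add0r sdk ?mem_flag_set//; last exact: flag_set_active fl.
by rewrite /deep_value s0 sik /=; case: ifP; rewrite ?mulr1 ?mulr0.
Qed.

Lemma deep_flag_min s js v : is_simplex s -> flag js v ->
  exists2 x, deep s x & forall y k, deep s y ->
    slack (flag_set js k) x <= slack (flag_set js k) y.
Proof.
move=> ss fl; have [x dx xk] := deep_flag ss fl; exists x => // y k dy.
by rewrite xk; exact: deep_value_le.
Qed.

Lemma supp_deep_frame s js v e : is_simplex s -> flag_frame js v e ->
  exists x, [/\ dot w x = c,
    forall k, dot (normal_sum (flag_set js k)) x
              = \sum_(j in flag_set js k) h j + deep_value s (flag_set js k)
  & forall u, (forall k, 0 <= dot u (e k)) -> supp (deep s) u = dot u x].
Proof.
move=> ss fr; have [fl _ _ _] := fr; have [x dx xk] := deep_flag ss fl; exists x; split.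
- by have /in_slice[] := deep_sub dx.
- by move=> k; have := xk k; rewrite slackE; lra.
apply: (supp_frame (@deep_sub s) fr dx) => y k dy.
by rewrite xk; exact: deep_value_le.
Qed.

Lemma supp_deep_normal s t : is_simplex s -> is_simplex t -> t != finset.set0 ->
  supp (deep s) (normal_sum t) = \sum_(j in t) h j + deep_value s t.
Proof.
move=> ss st t0; have [js [v [k [fl <-]]]] := simplex_flag nr card_active st t0.
have [e fr] := flag_framed fl; have [_ _ ee _] := fr.
have [x [_ xk ->]] := supp_deep_frame ss fr; first exact: xk.
by move=> l; rewrite ee ler0n.
Qed.

Lemma supp_deep_axis s : is_simplex s -> supp (deep s) w = c.
Proof.
move=> ss; have [js [v [e [fr _]]]] := flag_cone nr card_active S_neq0 0.
have [x [<- _ ->]] := supp_deep_frame ss fr => // k.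
by have [_ -> _ _] := fr.
Qed.

Lemma deep_neq0 s : is_simplex s -> deep s !=set0.
Proof.
move=> ss; have [js [v [e [fr _]]]] := flag_cone nr card_active S_neq0 0.
by have [fl _ _ _] := fr; have [x dx _] := deep_flag ss fl; exists x.
Qed.

(** The basis is indexed by polytopes, so distinct faces must give distinct truncations; the values
    at face normals tell them apart. *)
Lemma deep_inj s t : is_simplex s -> is_simplex t -> deep s = deep t -> s = t.
Proof.
move=> ss st dst.
have vE q : is_simplex q -> q != finset.set0 -> deep_value s q = deep_value t q.
  move=> sq q0; have := supp_deep_normal ss sq q0; rewrite dst supp_deep_normal//.
  by move=> /addrI.
have half q r : is_simplex q -> is_simplex r -> deep_value r q = deep_value q q ->
    q != finset.set0 -> r != finset.set0 /\ r \subset q.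
  move=> sq sr rq q0; move: rq; rewrite [RHS]/deep_value q0 fintype.subxx /=.
  rewrite /deep_value; case: ifP => [/andP[]//|_ d0].
  by have := simplex_depth_gt0 sq q0; rewrite -d0 ltxx.
have [s0|s0] := eqVneq s finset.set0; have [t0|t0] := eqVneq t finset.set0.
- by rewrite s0 t0.
- by have [] := half t s st ss (vE t st t0) t0; rewrite s0 eqxx.
- by have [] := half s t ss st (esym (vE s ss s0)) s0; rewrite t0 eqxx.
have [_ ts] := half s t ss st (esym (vE s ss s0)) s0.
have [_ st'] := half t s st ss (vE t st t0) t0.
by apply/eqP; rewrite finset.eqEsubset st' ts.
Qed.

Lemma deep_polytope s : (forall j, integral_vec (U j)) -> integral_vec w ->
  (exists M, forall x, S x -> forall i, `|x 0 i| <= M) -> is_simplex s ->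
  polytope (deep s).
Proof.
move=> Ui wi [M SM] ss.
have sni K (a : K -> V) : (forall k, integral_vec (a k)) ->
    forall k, integral_vec (slice_normal w a k).
  move=> ai [[]|k] /=; [exact: wi| |exact: ai].
  by apply/mxOverP => i j; rewrite mxE rpredN; have /mxOverP := wi; apply.
have bd : exists M, forall x, deep s x -> forall i, `|x 0 i| <= M.
  by exists M => x /deep_sub; exact: SM.
have := deep_neq0 ss; move: bd; rewrite /deep; case: ifP => _ bd ne.
  by apply: integral_polytope => //; exact: sni.
rewrite cutE in bd ne *; apply: integral_polytope => //; apply: sni => -[j|t] //=.
case: ifP => _; apply/mxOverP => i j; rewrite ?summxE ?mxE ?rpred0// rpred_sum// => k _.
by have /mxOverP := Ui k; apply.
Qed.

End DeepTruncations.

(** * The basis of the deformation space *)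

Section Basis.
Variables (R : realType) (m : nat) (J : finType).
Local Notation V := 'rV[R]_(m.+1).
Variables (U : J -> V) (h : J -> R) (w : V) (c : R).
Implicit Types (s t : {set J}) (x y v d u : V) (j : J) (js : 'I_m -> J).

Local Notation S := (polyhedron (slice_normal w U) (slice_offset c h)).
Local Notation active := (active U h).
Local Notation is_simplex := (is_simplex U h w c).
Local Notation cut := (cut U h w c).
Local Notation normal_sum := (normal_sum U).
Local Notation flag_frame := (flag_frame U h w c).
Local Notation deep := (deep U h w c).
Local Notation deep_value := (deep_value U h w c).

Hypothesis nr : no_recession (slice_normal w U).
Hypothesis card_active :
  forall v, basic (slice_normal w U) (slice_offset c h) v -> #|active v| = m.
Hypothesis S_neq0 : S !=set0.
Hypothesis c_neq0 : c != 0.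

Variables (I : {set {set J}}) (ep : {set J} -> R).
Hypothesis I_simplex : forall s, s \in I <-> is_simplex s /\ s != finset.set0.
Hypothesis I_vertices : cut_vertices U h w c I ep.

Local Notation P := (cut I ep).
Local Notation simplices := [set s : {set J} | `[< is_simplex s >]]%SET.

Lemma simplicesP s : reflect (is_simplex s) (s \in simplices).
Proof. by rewrite inE; exact: asboolP. Qed.

Lemma supp_deep_PL s : is_simplex s -> PL (normal_fan P) (supp (deep s)).
Proof.
move=> ss C /(normal_fanP nr card_active S_neq0 I_simplex I_vertices)[u ->].
have [js [v [e [fr u0]]]] := flag_cone nr card_active S_neq0 u.
have [x [_ _ sx]] := supp_deep_frame nr card_active S_neq0 ss fr.
exists (dotr x) => u' nu'; apply: sx => k.
by have [] := normal_cone_frame nr card_active I_simplex I_vertices fr u0 nu' k.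
Qed.

Lemma PL_frame f js v e u l : PL (normal_fan P) f -> flag_frame js v e ->
  (forall k, 0 <= dot u (e k)) ->
  u = \sum_k dot u (e k) *: normal_sum (flag_set js k) + l *: w ->
  f u = \sum_k dot u (e k) * f (normal_sum (flag_set js k)) + l * f w.
Proof.
move=> fPL fr u0 uE; have [fl we ee _] := fr.
have [C CP Ce] := flag_cone_in_fan nr card_active S_neq0 I_simplex I_vertices fr.
have [L fL] := fPL C CP.
have fn k : f (normal_sum (flag_set js k)) = L (normal_sum (flag_set js k)).
  by apply/fL/Ce => i; rewrite ee ler0n.
have fw : f w = L w by apply/fL/Ce => i; rewrite we.
rewrite (fL u (Ce u u0)) {1}uE linearD linearZ/= linear_sum fw; congr (_ + _).
by apply: eq_bigr => k _; rewrite linearZ/= fn.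
Qed.

Lemma PL_ext f g : PL (normal_fan P) f -> PL (normal_fan P) g -> f w = g w ->
  (forall s, is_simplex s -> s != finset.set0 -> f (normal_sum s) = g (normal_sum s)) ->
  forall u, f u = g u.
Proof.
move=> fPL gPL fgw fg u.
have [js [v [e [fr u0]]]] := flag_cone nr card_active S_neq0 u.
have [fl _ _ /(_ u)[l uE]] := fr.
rewrite (PL_frame fPL fr u0 uE) (PL_frame gPL fr u0 uE) fgw; congr (_ + _).
apply: eq_bigr => k _; rewrite fg//; last exact: flag_set_neq0.
exact: (flag_set_simplex nr card_active _ fl).
Qed.

Lemma PL_sum (K : finType) (A : {set K}) (a : K -> R) (f : K -> V -> R) :
  (forall k, k \in A -> PL (normal_fan P) (f k)) ->
  PL (normal_fan P) (fun x => \sum_(k in A) a k * f k x).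
Proof.
move=> fPL C CP.
have H k : exists L : {scalar V}, k \in A -> forall x, C x -> f k x = L x.
  have [kA|kA] := boolP (k \in A); last by exists (dotr 0).
  by have [L fL] := fPL k kA C CP; exists L.
have [L LP] := choice H.
(* The combination of the linear forms [L k], written as the dot product with one vector. *)
pose y : V := \row_i \sum_(k in A) a k * L k (delta_mx 0 i).
exists (dotr y) => x Cx; rewrite /= /dotr.
transitivity (\sum_(k in A) a k * L k x).
  by apply: eq_bigr => k kA; rewrite (LP k kA).
rewrite /dot; under [RHS]eq_bigr do rewrite mxE mulr_sumr.
rewrite exchange_big/=; apply: eq_bigr => k _.
rewrite [x in LHS]row_sum_delta linear_sum mulr_sumr; apply: eq_bigr => i _.
by rewrite linearZ/=; ring.
Qed.

Lemma deep_family_sum (g : set V -> R) (F : set V -> V -> R) x :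
  \sum_(Q \in deep @` [set s | is_simplex s]) g Q * F Q x
  = \sum_(s in simplices) g (deep s) * F (deep s) x.
Proof.
have inj : set_inj [set s | is_simplex s] deep.
  move=> s t /set_mem ss /set_mem st; exact: deep_inj.
rewrite fsbig_image// -big_enum/=.
have -> : [set s | is_simplex s] = [set` enum simplices].
  apply/seteqP; split=> s /=; rewrite mem_enum; first by move=> ?; exact/simplicesP.
  by move=> /simplicesP.
by rewrite -fsbig_seq// enum_uniq.
Qed.

(** [deep_value s t] vanishes unless [s] is contained in [t], and is positive on the diagonal.
    Induction on the size of [t] settles the nonempty simplices, the total sum the empty one. *)
Lemma triangular_zero (a : {set J} -> R) :
  \sum_(s in simplices) a s = 0 ->
  (forall t, is_simplex t -> t != finset.set0 ->
    \sum_(s in simplices) a s * deep_value s t = 0) ->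
  forall s, is_simplex s -> a s = 0.
Proof.
move=> a0 av.
have pos t : is_simplex t -> t != finset.set0 -> a t = 0.
  move: {2}_.+1 (ltnSn #|t|) => k; elim: k t => // k IH t; rewrite ltnS => tk st t0.
  have := av t st t0; rewrite (bigD1 t)/=; last exact/simplicesP.
  rewrite big1 ?addr0; last first.
    move=> s /andP[/simplicesP ss nst]; rewrite /deep_value.
    case: ifP => [/andP[s0 sub]|_]; last by rewrite mulr0.
    rewrite IH ?mul0r//; apply: leq_trans tk; apply: proper_card.
    by rewrite finset.properEneq nst.
  move/eqP; rewrite mulf_eq0 => /orP[/eqP//|]; rewrite /deep_value t0 fintype.subxx/=.
  by rewrite gt_eqF// (simplex_depth_gt0 nr card_active S_neq0 st).
move=> s ss; have [s0|] := eqVneq s finset.set0; last exact: pos.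
move: a0; rewrite (bigD1 s)/=; last exact/simplicesP.
rewrite big1 ?addr0// => t /andP[/simplicesP st ts]; apply: pos => //.
by rewrite -s0.
Qed.

Lemma deep_basis :
  function_basis (PL (normal_fan P)) (deep @` [set s | is_simplex s]) (@supp R m.+1).
Proof.
have valw s : is_simplex s -> supp (deep s) w = c by exact: supp_deep_axis.
have valn s t : is_simplex s -> is_simplex t -> t != finset.set0 ->
    supp (deep s) (normal_sum t) = \sum_(j in t) h j + deep_value s t.
  exact: supp_deep_normal.
split.
- by move=> _ [s ss <-]; exact: supp_deep_PL.
(* All support functions equal [c] at [w], which forces [k] as the sum of the coefficients; [f'] is
   what the depths have to account for. *)
- move=> f fPL; pose k := f w / c.
  pose f' t := if t == finset.set0 then 0 else f (normal_sum t) - k * \sum_(j in t) h j.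
  have [b bf] := subset_sum_solve f'.
  have b0 : b finset.set0 = 0.
    have := bf finset.set0; rewrite /f' eqxx => <-.
    rewrite (big_pred1 finset.set0)// => t /=; by rewrite finset.subset0.
  pose dl s := depth S (simplex_face U h w c s) (normal_sum s).
  pose a1 s := b s / dl s.
  (* The coefficient of [S] itself corrects the total to [k]; it does not affect the values of
     [deep_value]. *)
  pose a s := if s == finset.set0
    then k - \sum_(t in simplices | t != finset.set0) a1 t else a1 s.
  (* Coefficients move from simplices to polytopes; by [deep_inj] this sum has a single term at each
     [deep s]. *)
  pose g Q := \sum_(s in simplices | `[< deep s = Q >]) a s.
  have gd s : is_simplex s -> g (deep s) = a s.
    move=> ss; rewrite /g (big_pred1 s)// => t /=; apply/andP/eqP.
      by move=> [/simplicesP st /asboolP]; exact: deep_inj.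
    by move=> ->; split; [exact/simplicesP|exact/asboolP].
  have asum : \sum_(s in simplices) a s = k.
    rewrite (bigD1 finset.set0)/=; last exact/simplicesP/simplex_set0.
    rewrite {1}/a eqxx addrC (eq_bigr a1); first by rewrite addrC subrK.
    by move=> s /andP[_ s0]; rewrite /a (negbTE s0).
  have aval t : is_simplex t -> t != finset.set0 ->
      \sum_(s in simplices) a s * deep_value s t = f' t.
    move=> st t0; rewrite -bf big_mkcond [RHS]big_mkcond/=; apply: eq_bigr => s _.
    rewrite /deep_value /a; have [->|s0] /= := eqVneq s finset.set0.
      by rewrite mulr0 b0 !if_same.
    case: (boolP (s \subset t)) => sub; last by rewrite mulr0 if_same.
    have ss : is_simplex s by exact: (is_simplex_sub nr card_active st sub).
    rewrite ifT; last exact/simplicesP.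
    by rewrite divfK// gt_eqF// (simplex_depth_gt0 nr card_active S_neq0 ss).
  exists g.
    apply: (@sub_finite_set _ _ (deep @` [set s | is_simplex s])).
      move=> Q /= gQ; apply: contrapT => nQ; move/negP: gQ; apply; apply/eqP.
      by apply: big1 => s /andP[/simplicesP ss /asboolP sQ]; case: nQ; exists s.
    exact/finite_image/finite_finset.
  move=> x; rewrite (deep_family_sum g (@supp R m.+1)).
  transitivity (\sum_(s in simplices) a s * supp (deep s) x); last first.
    by apply: eq_bigr => s /simplicesP ss; rewrite gd.
  apply: (PL_ext fPL (g := fun x => \sum_(s in simplices) a s * supp (deep s) x)).
  + by apply: PL_sum => s /simplicesP; exact: supp_deep_PL.
  + rewrite (eq_bigr (fun s => a s * c)) => [|s /simplicesP ss]; last by rewrite valw.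
    by rewrite -mulr_suml asum divfK.
  + move=> t st t0; rewrite (eq_bigr (fun s => a s * \sum_(j in t) h j + a s * deep_value s t)).
      rewrite big_split/= -mulr_suml asum aval// /f' (negbTE t0); ring.
    by move=> s /simplicesP ss; rewrite valn// mulrDr.
- move=> g _ g0.
  have z x : \sum_(s in simplices) g (deep s) * supp (deep s) x = 0.
    by rewrite -(deep_family_sum g (@supp R m.+1)).
  have sum0 : \sum_(s in simplices) g (deep s) = 0.
    have := z w; rewrite (eq_bigr (fun s => g (deep s) * c)) => [|s /simplicesP ss].
      by rewrite -mulr_suml => /eqP; rewrite mulf_eq0 (negbTE c_neq0) orbF => /eqP.
    by rewrite valw.
  move=> _ [s ss <-]; apply: (triangular_zero sum0) ss => t st t0.
  have := z (normal_sum t).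
  rewrite (eq_bigr (fun s => g (deep s) * \sum_(j in t) h j + g (deep s) * deep_value s t)).
    by rewrite big_split/= -mulr_suml sum0 mul0r add0r.
  by move=> q /simplicesP sq; rewrite valn// mulrDr.
Qed.

End Basis.

(** * Faces as simplices *)

Section FaceSimplices.
Variables (R : realType) (m : nat) (J : finType).
Local Notation V := 'rV[R]_(m.+1).
Variables (U : J -> V) (h : J -> R) (w : V) (c : R).
Variables (uG : set V -> V) (G : J -> set V).
Implicit Types (s t : {set J}) (F : set V) (j : J).

Local Notation S := (polyhedron (slice_normal w U) (slice_offset c h)).
Local Notation active := (active U h).
Local Notation is_simplex := (is_simplex U h w c).
Local Notation cut := (cut U h w c).
Local Notation deep := (deep U h w c).
Local Notation simplex_face := (simplex_face U h w c).

Hypothesis nr : no_recession (slice_normal w U).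
Hypothesis card_active :
  forall v, basic (slice_normal w U) (slice_offset c h) v -> #|active v| = m.
Hypothesis S_neq0 : S !=set0.
Hypothesis GE : forall j, G j = [set x | S x /\ dot (U j) x = h j].
Hypothesis UE : forall j, U j = uG (G j).
Hypothesis G_inj : injective G.
Hypothesis facetE : forall H, facet S H <-> exists j, H = G j.

Definition facet_set F : {set J} := [set j | `[< F `<=` G j >]].

Lemma facet_setP F j : reflect (F `<=` G j) (j \in facet_set F).
Proof. by rewrite inE; exact: asboolP. Qed.

Lemma face_normalE F : face_normal S uG F = normal_sum U (facet_set F).
Proof.
rewrite /face_normal; have -> : [set H | facet S H /\ F `<=` H] =
    G @` [set` enum (facet_set F)].
  apply/seteqP; split=> [H [/facetE[j ->] FG]|_ [j jF <-]].
    by exists j; rewrite //= mem_enum; exact/facet_setP.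
  move: jF; rewrite /= mem_enum => /facet_setP FG; split=> //.
  by apply/facetE; exists j.
rewrite fsbig_image; last by move=> i j _ _; exact: G_inj.
rewrite -fsbig_seq ?enum_uniq// big_enum/=.
by apply: eq_bigr => j _; rewrite -UE.
Qed.

(** The facets through a relative interior point [q] of [F] are those containing [F]. If [x] lies on
    all of them, the segment from [x] to [q] extends beyond [q] within [S], so [x] minimizes [u] as
    well. *)
Lemma face_simplex F : face S F -> F !=set0 ->
  is_simplex (facet_set F) /\ F = simplex_face (facet_set F).
Proof.
move=> [->[]//|[u Fu]] F0.
have FS : F `<=` S by rewrite Fu => x [].
have [q Fq qmin] : exists2 q, F q & forall y, F y ->
    tight (slice_normal w U) (slice_offset c h) q
    \subset tight (slice_normal w U) (slice_offset c h) y.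
  by apply: min_tight => //; rewrite Fu; exact: face_in_mid.
have [Sq uq] : face_in S u q by rewrite -Fu.
have qF : active q = facet_set F.
  apply/setP => j; apply/activeP/facet_setP => [jq y Fy|/(_ q Fq)].
    rewrite GE; split; first exact: FS.
    have := fintype.subsetP (qmin _ Fy) (inr j).
    by rewrite !slice_tight jq eqxx => /(_ isT)/eqP.
  by rewrite GE => -[].
split; first by exists q.
apply/seteqP; split=> x.
  move=> Fx; split; first exact: FS.
  by apply/fintype.subsetP => j /facet_setP/(_ x Fx); rewrite GE => -[_ ?]; exact/activeP.
rewrite -qF => -[Sx /fintype.subsetP qx].
have [/in_slice[wx _] /in_slice[wq _]] := (Sx, Sq).
have [||e e0 /(_ e)] := slice_small_step (d := q - x) Sq.
- by rewrite dotBr wx wq subrr.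
- move=> j /activeP jq; have /activeP jx := qx _ jq.
  by rewrite dotBr jx (activeP _ _ _ _ jq) subrr.
rewrite lexx ltW// => /(_ isT) /(supp_le u nr); rewrite !dot_simp -uq.
rewrite lerDl pmulr_rge0// subr_ge0 => xq; rewrite Fu; split=> //.
by apply/eqP; rewrite eq_le supp_le// andbT -uq.
Qed.

Lemma simplex_face_face s : is_simplex s ->
  [/\ face S (simplex_face s), simplex_face s !=set0 & facet_set (simplex_face s) = s].
Proof.
move=> ss; have [FE _] := simplex_faceE ss; have [x Sx xs] := ss; split.
- by right; exists (normal_sum U s).
- by exists x; split=> //; rewrite xs.
apply/setP => j; apply/facet_setP/idP => [/(_ x)|jS y [Sy /fintype.subsetP sy]].
  by rewrite GE -xs => -[|_ jx]; [split|exact/activeP].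
by rewrite GE; split=> //; exact/activeP/sy.
Qed.

Lemma face_proper F : face S F -> F !=set0 -> (F `<` S <-> facet_set F != finset.set0).
Proof.
move=> fF F0; have [_ FE] := face_simplex fF F0; split.
  move=> [_ nSF]; apply/eqP => s0; apply: nSF => x Sx.
  by rewrite FE s0; split=> //; rewrite finset.sub0set.
move=> s0; split; first by rewrite FE => x [].
have [x Sx x0] := simplex_set0 nr card_active S_neq0.
move=> /(_ x Sx); rewrite FE => -[_]; rewrite x0 finset.subset0.
exact/negP.
Qed.

Lemma simplex_face_proper s : is_simplex s -> s != finset.set0 ->
  [/\ face S (simplex_face s), simplex_face s !=set0 & simplex_face s `<` S].
Proof.
move=> ss s0; have [fs ne sE] := simplex_face_face ss; split=> //.
by apply/face_proper => //; rewrite sE.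
Qed.

Lemma simplex_face_sub s t : is_simplex t -> simplex_face t `<=` simplex_face s <-> s \subset t.
Proof.
move=> [x Sx xt]; split=> [/(_ x)[]|st y [Sy ty]]; first by split=> //; rewrite xt.
  by rewrite xt.
by split=> //; exact: fintype.subset_trans st ty.
Qed.

Lemma deep_truncationE :
  [set deep_truncation S uG F | F in [set F | face S F /\ F `<` S]]
  = deep @` [set s | is_simplex s].
Proof.
have dE s : is_simplex s -> s != finset.set0 ->
    deep_truncation S uG (simplex_face s) = deep s.
  move=> ss s0; have [_ sE] := simplex_faceE ss; have [_ [z Fz] fE] := simplex_face_face ss.
  rewrite /deep_truncation ifF; last by apply/asboolP => F0; rewrite F0 in Fz.
  rewrite face_normalE fE /deep (negbTE s0); apply/seteqP; split=> x.
    move=> [Sx]; rewrite sE => sx; split=> // t; rewrite finset.in_set1 => /eqP ->.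
    by rewrite slackE; lra.
  move=> [Sx /(_ s)]; rewrite finset.in_set1 eqxx slackE => /(_ isT) sx.
  by split=> //; rewrite sE; lra.
apply/seteqP; split=> [_ [F [fF FS] <-]|_ [s ss <-]].
  have [->|/set0P F0] := eqVneq F set0.
    exists finset.set0; first exact: (simplex_set0 nr card_active).
    by rewrite /deep_truncation asboolT// /deep eqxx.
  have [ss FE] := face_simplex fF F0; exists (facet_set F) => //.
  by rewrite [in RHS]FE dE//; apply/face_proper.
have [->|s0] := eqVneq s finset.set0.
  exists set0; last by rewrite /deep_truncation asboolT// /deep eqxx.
  split; first by left.
  by split=> // /(_ _ _) S0; have [x /S0] := S_neq0.
exists (simplex_face s); last exact: dE.
by have [fs _ sS] := simplex_face_proper ss s0.
Qed.

Lemma omnitruncation_cut P : omnitruncation S uG P -> exists I ep,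
  [/\ P = cut I ep, forall s, s \in I <-> is_simplex s /\ s != finset.set0
    & cut_vertices U h w c I ep].
Proof.
move=> [N [F [eps [T [[Ffun Finj Fsurj] Ford [T0 TN] Tstep]]]]].
pose ep s := eps (simplex_face s).
pose I_ (i : nat) : {set {set J}} := [set facet_set (F (val k)) | k : 'I_i].
have inI i s : reflect (exists2 k, (k < i)%N & s = facet_set (F k)) (s \in I_ i).
  apply: (iffP imsetP) => [[k _ ->]|[k ki ->]]; last by exists (Ordinal ki).
  by exists (val k) => //; exact: ltn_ord.
have FP k : (k < N)%N -> [/\ is_simplex (facet_set (F k)),
    facet_set (F k) != finset.set0 & F k = simplex_face (facet_set (F k))].
  move=> kN; have [fF F0 FS] := Ffun k kN; have [ss FE] := face_simplex fF F0.
  by split=> //; apply/face_proper.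
have Fs s : is_simplex s -> s != finset.set0 -> exists2 k, (k < N)%N & simplex_face s = F k.
  move=> ss s0; have [fs ne sS] := simplex_face_proper ss s0.
  by have [k kN <-] := Fsurj _ (And3 fs ne sS); exists k.
(* The order of truncation, read on facet sets: larger simplices come earlier. *)
have before k t : (k < N)%N -> is_simplex t -> facet_set (F k) \proper t ->
    exists2 l, (l < k)%N & t = facet_set (F l).
  move=> kN st kt; have [sk k0 Fk] := FP k kN.
  have t0 : t != finset.set0 by apply: contraTneq kt => ->; rewrite properE finset.sub0set andbF.
  have [l lN tl] := Fs t st t0; have [_ _ tE] := simplex_face_face st.
  exists l; last by rewrite -tl tE.
  move: kt; rewrite properE => /andP[kt tk].
  apply: Ford => //; rewrite -tl Fk; split; first exact/simplex_face_sub.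
  by move=> /(simplex_face_sub _ sk); exact/negP.
have H i : (i <= N)%N -> T i = cut (I_ i) ep /\ cut_vertices U h w c (I_ i) ep.
  elim: i => [_|i IH iN].
    have -> : I_ 0%N = finset.set0.
      by apply/setP => s; rewrite finset.in_set0; apply/negP => /inI[].
    split; last exact: cut_vertices0.
    by rewrite T0; apply/seteqP; split=> [x Sx|x []//]; split=> // s; rewrite finset.in_set0.
  have [TE vI] := IH (ltnW iN); have [ss s0 FE] := FP i iN.
  set s := facet_set (F i) in ss s0 FE.
  have -> : I_ i.+1 = s |: I_ i.
    apply/setP => t; rewrite finset.in_setU1; apply/inI/orP.
      move=> [k]; rewrite ltnS leq_eqVlt => /orP[/eqP -> ->|ki ->]; first by left.
      by right; apply/inI; exists k.
    move=> [/eqP ->|/inI[k ki ->]]; first by exists i.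
    by exists k => //; exact: ltnW.
  have := Tstep i iN; rewrite face_normalE -/s TE [F i]FE -/(ep s).
  move=> [/andP[e0 esh] ->].
  have up t t' : t \in I_ i -> t \subset t' -> is_simplex t' -> t' \in I_ i.
    move=> /inI[k ki ->]; rewrite finset.subEproper => /orP[/eqP <- _|kt st'].
      by apply/inI; exists k.
    have [l lk ->] := before k t' (ltn_trans ki iN) st' kt.
    by apply/inI; exists l => //; exact: ltn_trans lk ki.
  have sI : s \notin I_ i.
    apply/negP => /inI[k ki sk]; have kN := ltn_trans ki iN.
    have [_ _ Fk] := FP k kN; have : k = i.
      by apply: Finj; rewrite ?inE//= Fk FE sk.
    by move=> e; rewrite e ltnn in ki.
  have smax t : is_simplex t -> s \proper t -> t \in I_ i.
    by move=> st /(before i t iN st)[l li ->]; apply/inI; exists l.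
  split; first exact/esym/cut_truncation.
  exact: (cut_vertices_step nr card_active up ss s0 sI smax vI e0 esh).
have [TE vI] := H N (leqnn N); exists (I_ N), ep; split=> //; first by rewrite -TN TE.
move=> s; split=> [/inI[k kN ->]|[ss s0]]; first by have [] := FP k kN.
have [k kN sk] := Fs s ss s0; apply/inI; exists k => //; rewrite -sk.
by have [_ _ ->] := simplex_face_face ss.
Qed.

End FaceSimplices.

Theorem proposition4p38 (R : realType) (n : nat) (S P : set 'rV[R]_n)
    (uG : set 'rV[R]_n -> 'rV[R]_n)
    (n_gt0 : (0 < n)%N)
    (S_dim : has_dim S n.-1)
    (S_simple : simple_polytope S)
    (S_notlinear : ~ aff_span S 0)
    (uG_normals : facet_normals S uG)
    (P_omni : omnitruncation S uG P) :
  polytopal_basis P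
    [set deep_truncation S uG F | F in [set F | face S F /\ F `<` S]].
Proof.
case: n n_gt0 S P uG S_dim S_simple S_notlinear uG_normals P_omni => // m _ /=.
move=> S P uG S_dim S_simple S_notlinear uG_normals P_omni.
have [J [G [w [c [[wi c0] G_inj facetE SE Gv]]]]] :=
  facet_description S_dim S_simple S_notlinear uG_normals.
have [[S_neq0 _ S_bd _ _] _] := S_simple.
pose U j := uG (G j).
have Gfacet j : facet S (G j) by apply/facetE; exists j.
have Ui j : integral_vec (U j) by have [] := uG_normals _ (Gfacet j).
have [h [SP GE]] : exists h : J -> R, S = polyhedron (slice_normal w U) (slice_offset c h)
    /\ forall j, G j = [set x | S x /\ dot (U j) x = h j].
  exists (fun j => supp S (U j)); split; first by rewrite polyhedron_slice [LHS]SE.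
  by move=> j; have [_ -> _] := uG_normals _ (Gfacet j).
have UE j : U j = uG (G j) by [].
move: U UE SP GE Ui => U UE SP GE Ui; clear SE; subst S.
have nr := bounded_no_recession S_neq0 S_bd.
have card_active v : basic (slice_normal w U) (slice_offset c h) v -> #|active U h v| = m.
  move=> bv; apply: etrans (Gv v _); last exact/basic_vertex.
  apply: eq_card => j; apply/activeP/idP; rewrite inE.
    by move=> jv; apply/asboolP; rewrite GE; split=> //; case: bv.
  by move/asboolP; rewrite GE => -[].
have [I [ep [-> I_simplex I_vertices]]] :=
  omnitruncation_cut nr card_active S_neq0 GE UE G_inj facetE P_omni.
rewrite (deep_truncationE nr card_active S_neq0 GE UE G_inj facetE).
split; last exact: (deep_basis nr card_active S_neq0 c0 I_simplex I_vertices).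
move=> _ [s ss <-]; split; first exact: deep_polytope.
apply: (fan_coarsens nr card_active S_neq0 I_simplex I_vertices (@deep_sub _ _ _ _ _ _ _ s)).
by move=> js v; exact: deep_flag_min.
Qed.
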